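(* Let $P$ be the condensation measure associated with the infinite discrete distribution $\nu$, and let $D(P)$ be its quantization dimension. The $D(P)$-dimensional quantization coefficient for $P$ does not exist, i.e., $\lim_{n\to\infty}n^{2/D(P)}V_n(P)$ does not exist, and the $D(P)$-dimensional lower and upper quantization coefficients for $P$ are finite and positive, i.e., $0<\liminf_{n\to\infty}n^{2/D(P)}V_n(P)\le\limsup_{n\to\infty}n^{2/D(P)}V_n(P)<\infty$.
   Context: For $j\in\mathbb N=\{1,2,\dots\}$ let $a_j=\frac25+\frac15\cdot\frac{2^{j-1}-1}{2^{j-1}}$, and let $\nu$ be the Borel probability measure on $\mathbb R$ with $\nu(\{a_j\})=2^{-j}$ for all $j\in\mathbb N$. Let $S_1(x)=\frac15x$ and $S_2(x)=\frac15x+\frac45$ for $x\in\mathbb R$. The condensation measure $P$ associated with $\nu$ is the unique Borel probability measure on $\mathbb R$ with $P=\frac13P\circ S_1^{-1}+\frac13P\circ S_2^{-1}+\frac13\nu$. For a Borel probability measure $\mu$ on $\mathbb R$ the $n$th quantization error (of order $2$) is $V_n(\mu)=\inf\{\int\min_{a\in\alpha}(x-a)^2\,d\mu(x):\alpha\subseteq\mathbb R,\ 1\le\mathrm{card}(\alpha)\le n\}$. The quantization dimension is $D(\mu)=\lim_{n\to\infty}\frac{2\log n}{-\log V_n(\mu)}$ when the limit exists; for $P$ it exists and equals $D(P)=\frac{2\log2}{\log75-\log2}$. For $s>0$, the $s$-dimensional lower and upper quantization coefficients of $\mu$ are $\liminf_n n^{2/s}V_n(\mu)$ and $\limsup_n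 n^{2/s}V_n(\mu)$; the $s$-dimensional quantization coefficient is $\lim_n n^{2/s}V_n(\mu)$ when it exists. *)

(* Defs.v *)
From HB Require Import structures.
From mathcomp Require Import all_boot all_order all_algebra finmap.
From mathcomp Require Import all_classical all_reals all_analysis.

Set Implicit Arguments.
Unset Strict Implicit.
Unset Printing Implicit Defensive.

Import Order.TTheory GRing.Theory Num.Theory.
Import numFieldTopology.Exports numFieldNormedType.Exports.

Local Open Scope classical_set_scope.
Local Open Scope ring_scope.

Section Quantization.
Context {R : realType}.
Implicit Types (mu : probability (measurableTypeR R) R) (s : R).

(* The minimum is taken in \bar R so that +oo is a neutral element; for a
   nonempty alpha it is the real number min_(a in alpha) (x - a)^2. *)
Definition distortion mu (alpha : {fset R}) : \bar R :=
  (\int[mu]_x \big[mine/+oo]_(a <- alpha) ((x - a) ^+ 2)%:E)%E.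

Definition quant_error mu (n : nat) : \bar R :=
  ereal_inf [set distortion mu alpha |
    alpha in [set alpha : {fset R} | (1 <= #|` alpha| <= n)%N]].

(* Meaningful only when the limit exists and mu has a finite second moment:
   the latter makes the errors real numbers for n >= 1, so that [fine] loses
   nothing. *)
Definition quant_dimension mu : R :=
  limn (fun n : nat => 2 * ln n%:R / - ln (fine (quant_error mu n)) : R).

Definition quant_coeff_seq s mu (n : nat) : \bar R :=
  ((n%:R `^ (2 / s))%:E * quant_error mu n)%E.

Definition lower_quant_coeff s mu : \bar R := limn_einf (quant_coeff_seq s mu).

Definition upper_quant_coeff s mu : \bar R := limn_esup (quant_coeff_seq s mu).

End Quantization.

Section Condensation.
Variable R : realType.
Implicit Types (nu P : probability (measurableTypeR R) R).

(* Used for j >= 1 only. *)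
Definition atom (j : nat) : R :=
  2 / 5 + 1 / 5 * ((2 ^+ (j - 1) - 1) / 2 ^+ (j - 1)).

(* The masses sum to 1, so this determines the probability measure nu. *)
Definition is_dyadic_discrete nu : Prop :=
  forall j : nat, (1 <= j)%N -> nu [set atom j] = (2 ^- j)%:E.

Definition S1 (x : measurableTypeR R) : measurableTypeR R := 1 / 5 * x.

Definition S2 (x : measurableTypeR R) : measurableTypeR R := 1 / 5 * x + 4 / 5.

(* Given nu, exactly one probability measure P satisfies this equation. *)
Definition is_condensation_measure nu P : Prop :=
  forall A : set (measurableTypeR R), measurable A ->
    P A = ((1 / 3)%:E * pushforward P S1 A + (1 / 3)%:E * pushforward P S2 A
           + (1 / 3)%:E * nu A)%E.

End Condensation.

(* Main.v *)
Require Import Defs.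
From HB Require Import structures.
From mathcomp Require Import all_boot all_order all_algebra finmap.
From mathcomp Require Import all_classical all_reals all_analysis.
From mathcomp Require Import measurable_realfun ring lra zify.
Import Order.TTheory GRing.Theory Num.Theory.
Import numFieldTopology.Exports numFieldNormedType.Exports.
Local Open Scope classical_set_scope.
Local Open Scope ring_scope.

(** Write V n and W n for the n-th quantization errors of P and nu, and let
    a = log2 (75 / 2), which is 2 / D(P).

    Self-similarity. P consists of two copies of itself, of weight 1/3 and
    ratio 1/5, and of a copy of nu of weight 1/3 lying between them. Hence
    V (n1 + n2 + m) <= (V n1 + V n2) / 75 + W m / 3 [P_qerr_assemble]. The
    converse holds as soon as the error is small [P_qerr_split]: a codebook of
    small distortion has a point near each end of each gap between the three
    parts, so no codebook point is nearest to points of two parts, and the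
    codebook splits into three independent ones.

    Order of magnitude. W decays like 8^-m, so that about log n points settle
    the middle part and doubling n divides V by 75/2: V n <= C n^-a
    [error_upper]. Conversely, the 2^k copies of depth k each contribute at
    least 75^-k unless a codebook point serves them, so
    75^-k (2^k - n) <= V n [P_qerr_lower]. Thus n^a V n stays between two
    positive constants; taking logarithms, the quantization dimension is 2 / a.

    No limit. Penalize each codebook point by a price lam and minimize
    V n + lam n. Up to the constraint that the error be small, the recursion
    decouples: if n minimizes V n + 75 lam n and m minimizes W m + 3 lam m, then
    2 n + m minimizes V + lam [penalized_min_recursion]. At some price lam the
    minimum is reached at two sizes n and n + d [penalized_min_kink]; dividing
    the price by 75^k, it is reached at N and at N + 2^k d, with N of order 2^k
    [ties_at_all_scales]. So V lies above its chord at the middle of an interval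
    whose length is a fixed proportion of its position. If n^a V n converged to
    L > 0, then V n would be close to L n^-a, which lies below its chords by a
    fixed factor there, a contradiction [ties_prevent_limit]. *)

(** * Distance to a codebook *)

(** Empty codebooks are allowed, at distance +oo: cutting a codebook in two may
    leave one of the halves empty. *)
Definition sqdist {R : realType} (alpha : {fset R}) (x : R) : \bar R :=
  \big[mine/+oo%E]_(a <- alpha) ((x - a) ^+ 2)%:E.

Section SquareDistance.
Context {R : realType}.
Implicit Types (alpha beta : {fset R}) (a x y r : R).
Local Open Scope fset_scope.

Lemma le_sqdist alpha x (y : \bar R) :
  (forall a, a \in alpha -> (y <= ((x - a) ^+ 2)%:E)%E) ->
  (y <= sqdist alpha x)%E.
Proof.
move=> h; rewrite /sqdist big_seq.
by apply: le_bigmin; rewrite ?leey.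
Qed.

Lemma sqdist_le alpha x a : a \in alpha ->
  (sqdist alpha x <= ((x - a) ^+ 2)%:E)%E.
Proof. by move=> aal; rewrite /sqdist; apply: bigmin_inf_seq => //. Qed.

Lemma sqdist_ge0 alpha x : (0 <= sqdist alpha x)%E.
Proof. by apply: le_sqdist => a _; rewrite lee_fin sqr_ge0. Qed.

Lemma measurable_sqdist alpha :
  measurable_fun setT (fun x : measurableTypeR R => sqdist alpha x).
Proof.
rewrite /sqdist; elim: (enum_fset alpha) => [|a s IH].
  by under eq_fun do rewrite big_nil; exact: measurable_cst.
under eq_fun do rewrite big_cons.
apply: measurable_mine => //.
apply/measurable_EFinP; apply: measurable_funX.
by apply: measurable_funB => //; exact: measurable_id.
Qed.

(** The ratio r is 1/25 or 25 when x and y correspond under a similarity of ratio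
    1/5, and 1 when points are added to a codebook or dropped from it. *)
Lemma sqdist_comparison alpha beta x y r : 0 <= r ->
  (forall b, b \in beta ->
     exists2 a, a \in alpha & r * (x - a) ^+ 2 <= (y - b) ^+ 2) ->
  (r%:E * sqdist alpha x <= sqdist beta y)%E.
Proof.
move=> r0 h; apply: le_sqdist => b /h[a aal hab].
apply: (@le_trans _ _ (r%:E * ((x - a) ^+ 2)%:E)%E).
  by apply: lee_wpmul2l; [rewrite lee_fin|exact: sqdist_le].
by rewrite -EFinM lee_fin.
Qed.

Lemma distortionE (mu : probability (measurableTypeR R) R) alpha :
  distortion mu alpha = (\int[mu]_x sqdist alpha x)%E.
Proof. by []. Qed.

Lemma distortion_ge0 (mu : probability (measurableTypeR R) R) alpha :
  (0 <= distortion mu alpha)%E.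
Proof. by rewrite distortionE; apply: integral_ge0 => x _; exact: sqdist_ge0. Qed.

End SquareDistance.

(** * Integrals against a measure carried by a set *)

Section Carried.
Context {R : realType}.
Variables (mu : probability (measurableTypeR R) R).

(** Distances compare well only at points of the support, so the pointwise
    bounds below are available on a set of full mass only. *)
Lemma le_integral_carried (A : set (measurableTypeR R))
    (f g : measurableTypeR R -> \bar R) :
  measurable A -> mu (~` A) = 0%E ->
  measurable_fun setT f -> measurable_fun setT g ->
  (forall x, 0 <= f x)%E -> (forall x, 0 <= g x)%E ->
  (forall x, A x -> f x <= g x)%E ->
  (\int[mu]_x f x <= \int[mu]_x g x)%E.
Proof.
move=> mA A0 mf mg f0 g0 fg; apply: ae_ge0_le_integral => //.
exists (~` A); split => //; first exact: measurableC.
by move=> x /= h Ax; apply: h => _; exact: fg.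
Qed.

Lemma integral_ge_mass (A : set (measurableTypeR R))
    (f : measurableTypeR R -> \bar R) (c : R) :
  measurable A -> measurable_fun setT f -> (forall x, 0 <= f x)%E -> 0 <= c ->
  (forall x, A x -> c%:E <= f x)%E ->
  (c%:E * mu A <= \int[mu]_x f x)%E.
Proof.
move=> mA mf f0 c0 cf; rewrite -integral_cst//.
apply: (@le_trans _ _ (\int[mu]_(x in A) f x)%E).
  apply: ge0_le_integral => //.
  exact: (measurable_funS measurableT).
exact: ge0_subset_integral.
Qed.
End Carried.

(** * The dyadic discrete measure *)

Section DyadicDiscrete.
Context {R : realType}.
Variable nu : probability (measurableTypeR R) R.
Hypothesis hnu : is_dyadic_discrete nu.

Lemma atomE j : atom R j.+1 = 3 / 5 - 1 / 5 * 2 ^- j.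
Proof.
rewrite /atom subn1 /=; have h : (2 : R) ^+ j != 0 by rewrite expf_neq0.
by field.
Qed.

Lemma atom_bounds m j : (m <= j)%N ->
  atom R m.+1 <= atom R j.+1 < 3 / 5.
Proof.
move=> mj; rewrite !atomE.
have h : (2 : R) ^- j <= 2 ^- m.
  by rewrite lef_pV2 ?posrE ?exprn_gt0// ler_eXn2l// ltr1n.
have h0 : 0 < (2 : R) ^- j by rewrite invr_gt0 exprn_gt0.
lra.
Qed.

Lemma atom_ge j : 2 / 5 <= atom R j.+1.
Proof.
have /andP[+ _] := atom_bounds 0 j (leq0n j).
by apply: le_trans; rewrite atomE expr0; lra.
Qed.

Lemma atom_inj : injective (fun j => atom R j.+1).
Proof.
move=> i j /=; rewrite !atomE => h.
have /invr_inj : (2 : R) ^- i = 2 ^- j by lra.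
by apply: ieexprIn; lra.
Qed.

Definition first_atoms m : set (measurableTypeR R) :=
  [set x | exists2 j, (j < m)%N & x = atom R j.+1].

Lemma first_atomsS m :
  first_atoms m.+1 = first_atoms m `|` [set atom R m.+1].
Proof.
apply/seteqP; split => x /=.
  move=> [j]; rewrite ltnS leq_eqVlt => /predU1P[->|jm] ->; first by right.
  by left; exists j.
by case=> [[j jm ->]|->]; [exists j => //; exact: ltnW|exists m].
Qed.

Lemma measurable_first_atoms m : measurable (first_atoms m).
Proof.
elim: m => [|m IH].
  rewrite (_ : first_atoms 0 = set0)//.
  by apply/seteqP; split => x //= -[j].
by rewrite first_atomsS; apply: measurableU => //; exact: measurable_set1.
Qed.

Lemma nu_first_atoms m : nu (first_atoms m) = (1 - 2 ^- m)%:E.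
Proof.
elim: m => [|m IH].
  rewrite (_ : first_atoms 0 = set0); first by rewrite measure0 expr0 invr1 subrr.
  by apply/seteqP; split => x //= -[j].
rewrite first_atomsS measureU//=.
- rewrite [X in (X + _)%E]IH [X in (_ + X)%E]hnu// -EFinD; congr EFin.
  have h : (2 : R) ^+ m != 0 by rewrite expf_neq0.
  by rewrite exprS; field.
- exact: measurable_first_atoms.
- apply/seteqP; split => x //= [[j jm ->]] /atom_inj jm'.
  by rewrite jm' ltnn in jm.
Qed.

Lemma nu_other_atoms m : nu (~` first_atoms m) = (2 ^- m)%:E.
Proof.
rewrite probability_setC; last exact: measurable_first_atoms.
rewrite [X in (_ - X)%E]nu_first_atoms -EFinB; congr EFin; ring.
Qed.

Definition atoms : set (measurableTypeR R) := \bigcup_m first_atoms m.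

Lemma measurable_atoms : measurable atoms.
Proof. by apply: bigcupT_measurable => m; exact: measurable_first_atoms. Qed.

(** The complement of the atoms lies in that of the first m atoms, of mass 2^-m,
    for every m. *)
Lemma nu_carried_atoms : nu (~` atoms) = 0%E.
Proof.
apply/eqP; rewrite eq_le measure_ge0 andbT.
have h m : (nu (~` atoms) <= (2 ^- m)%:E)%E.
  rewrite -nu_other_atoms; apply: le_measure; rewrite ?inE.
  - by apply: measurableC; exact: measurable_atoms.
  - by apply: measurableC; exact: measurable_first_atoms.
  - by apply: subsetC => x Fx; exists m.
apply/lee_addgt0Pr => e e0; rewrite add0e.
near \oo => m; apply: (le_trans (h m)); rewrite lee_fin.
near: m.
have : (fun m => (2^-1 : R) ^+ m) @ \oo --> (0 : R).
  by apply: cvg_expr; rewrite ger0_norm; lra.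
move=> /cvgr0Pnorm_le /(_ _ e0); apply: filterS => m.
by rewrite ger0_norm ?exprVn// invr_ge0 exprn_ge0.
Unshelve. all: by end_near. Qed.

Lemma atoms_bounds x : atoms x -> 2 / 5 <= x < 3 / 5.
Proof.
move=> [m _ [j _ ->]]; rewrite atom_ge /=.
by have /andP[] := atom_bounds j j (leqnn j).
Qed.

End DyadicDiscrete.

(** * Self-similarity of the condensation measure *)

Section Condensation.
Context {R : realType}.
Variables (nu P : probability (measurableTypeR R) R).
Hypothesis hP : is_condensation_measure nu P.

Lemma measurable_S1 : measurable_fun setT (@S1 R).
Proof. by apply: measurable_funM => //; exact: measurable_id. Qed.

Lemma measurable_S2 : measurable_fun setT (@S2 R).
Proof. by apply: measurable_funD. Qed.

(** The equation that defines P says that P is the sum of three scaled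
    measures, two of them images of P. *)
Lemma integral_condensation (f : measurableTypeR R -> \bar R) :
  measurable_fun setT f -> (forall x, 0 <= f x)%E ->
  (\int[P]_x f x = (1 / 3)%:E * \int[P]_x f (S1 x)
    + (1 / 3)%:E * \int[P]_x f (S2 x) + (1 / 3)%:E * \int[nu]_x f x)%E.
Proof.
move=> mf f0; have h3 : 0 <= 1 / 3 :> R by lra.
pose k := NngNum h3.
(* These two are measures only because S1 and S2 are measurable: both poses
   are functions of a proof of it. *)
pose m1 : {measure set (measurableTypeR R) -> \bar R} :=
  mscale k (pushforward P (@S1 R)).
pose m2 : {measure set (measurableTypeR R) -> \bar R} :=
  mscale k (pushforward P (@S2 R)).
pose m3 : {measure set (measurableTypeR R) -> \bar R} := mscale k nu.
pose m12 : {measure set (measurableTypeR R) -> \bar R} :=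
  measure_add (m1 measurable_S1) (m2 measurable_S2).
have addE (a b : {measure set (measurableTypeR R) -> \bar R}) :
    (\int[measure_add a b]_x f x = \int[a]_x f x + \int[b]_x f x)%E.
  exact: ge0_integral_measure_add.
have scaleE (a : {measure set (measurableTypeR R) -> \bar R}) :
    (\int[mscale k a]_x f x = (1 / 3)%:E * \int[a]_x f x)%E.
  by rewrite ge0_integral_mscale.
have -> : (\int[P]_x f x = \int[measure_add m12 m3]_x f x)%E.
  apply: eq_measure_integral => A mA _.
  apply/esym; apply: (etrans (measure_addE _ _ _)).
  apply: (etrans _ (esym (hP A mA))).
  by congr (_ + _)%E; exact: measure_addE.
rewrite !addE !scaleE !ge0_integral_pushforward//.
- exact: measurable_S2.
- exact: measurable_S1.
Qed.

Hypothesis hnu : is_dyadic_discrete nu.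

Definition unit_itv : set (measurableTypeR R) := `[0, 1]%classic.

Lemma measurable_unit_itv : measurable unit_itv.
Proof. exact: measurable_itv. Qed.

Lemma unit_itvP x : unit_itv x <-> 0 <= x <= 1.
Proof. by rewrite /unit_itv /= in_itv. Qed.

(** S1 and S2 map the unit interval into itself, so the preimages of its
    complement C lie in C, and nu C = 0: the defining equation yields
    P C <= 2/3 P C. *)
Lemma condensation_carried : P (~` unit_itv) = 0%E.
Proof.
have mC := measurableC measurable_unit_itv.
have le1 : (P (@S1 R @^-1` ~` unit_itv) <= P (~` unit_itv))%E.
  apply: le_measure; rewrite ?inE//.
    by rewrite -[X in measurable X]setTI; exact: measurable_S1.
  move=> x /=; apply: contra_not => /unit_itvP x01.
  by apply/unit_itvP; rewrite /S1; lra.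
have le2 : (P (@S2 R @^-1` ~` unit_itv) <= P (~` unit_itv))%E.
  apply: le_measure; rewrite ?inE//.
    by rewrite -[X in measurable X]setTI; exact: measurable_S2.
  move=> x /=; apply: contra_not => /unit_itvP x01.
  by apply/unit_itvP; rewrite /S2; lra.
have nu0 : nu (~` unit_itv) = 0%E.
  apply/eqP; rewrite eq_le measure_ge0 andbT -(nu_carried_atoms _ hnu).
  apply: le_measure; rewrite ?inE//.
    by apply: measurableC; exact: measurable_atoms.
  by apply: subsetC => x /atoms_bounds h; apply/unit_itvP; lra.
have : (P (~` unit_itv) <= (1 / 3)%:E * P (~` unit_itv)
                          + (1 / 3)%:E * P (~` unit_itv))%E.
  rewrite [leLHS](hP _ mC) /pushforward nu0 mule0 adde0.
  by apply: leeD; apply: lee_wpmul2l => //; rewrite lee_fin; lra.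
have : (0 <= P (~` unit_itv))%E by exact: measure_ge0.
have : P (~` unit_itv) \is a fin_num by exact: fin_num_measure.
case: (P (~` unit_itv)) => [a| |]//= _.
by rewrite !lee_fin => a0 ale; congr EFin; lra.
Qed.

End Condensation.

(** * Cutting and assembling codebooks *)

Section FiniteSets.
Context {T : choiceType}.
Implicit Types (A : {fset T}) (p q : pred T).
Local Open Scope fset_scope.

Lemma card_fset_filterC A p :
  (#|` [fset x in A | p x]| + #|` [fset x in A | ~~ p x]| = #|` A|)%N.
Proof.
rewrite -(cardfsID [fset x in A | p x] A); congr (_ + _)%N; congr #|` _|.
  by apply/fsetP => x; rewrite !inE /=; case: (x \in A).
by apply/fsetP => x; rewrite !inE /=; case: (x \in A); rewrite ?andbT ?andbF.
Qed.

(** For g the inverse of a similarity S, this is the part of the codebook that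
    serves the image of S, in the coordinates of the source of S. *)
Definition pullback (g : T -> T) p A : {fset T} :=
  [fset g b | b in [fset b in A | p b]].

Lemma card_pullback g p A :
  (#|` pullback g p A| <= #|` [fset b in A | p b]|)%N.
Proof. exact: leq_imfset_card. Qed.

End FiniteSets.

Section Similarities.
Context {R : realType}.
Implicit Types (alpha beta : {fset R}) (a b x y r : R).

Definition S1inv b : R := 5 * b.
Definition S2inv b : R := 5 * b - 4.

Lemma S1_sqr x b : (S1 x - b) ^+ 2 = 1 / 25 * (x - S1inv b) ^+ 2.
Proof. by rewrite /S1 /S1inv; field. Qed.

Lemma S2_sqr x b : (S2 x - b) ^+ 2 = 1 / 25 * (x - S2inv b) ^+ 2.
Proof. by rewrite /S2 /S2inv; field. Qed.

Lemma sqdist_pullback (S g : R -> R) (p : pred R) alpha x :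
  (forall y b, (S y - b) ^+ 2 = 1 / 25 * (y - g b) ^+ 2) ->
  (forall b, b \in alpha -> ~~ p b -> exists2 a, a \in alpha &
     p a /\ (S x - a) ^+ 2 <= (S x - b) ^+ 2) ->
  ((1 / 25)%:E * sqdist (pullback g p alpha) x <= sqdist alpha (S x))%E.
Proof.
move=> hS near; apply: sqdist_comparison; first by lra.
have pull a : a \in alpha -> p a -> g a \in pullback g p alpha.
  by move=> aal pa; apply: in_imfset => /=; rewrite !inE /= aal.
move=> b bal; have [pb|npb] := boolP (p b).
  by exists (g b); [exact: pull|rewrite hS].
have [a aal [pa ab]] := near b bal npb.
by exists (g a); [exact: pull|rewrite -hS].
Qed.

(** With costs truncated at 1, no point outside p matters: on the image of S it
    costs at least 1/25, which is the largest value of the left-hand side. *)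
Lemma truncated_sqdist_pullback (S g : R -> R) (p : pred R) alpha x :
  (forall y b, (S y - b) ^+ 2 = 1 / 25 * (y - g b) ^+ 2) ->
  (forall b, ~~ p b -> 1 / 25 <= (S x - b) ^+ 2) ->
  ((1 / 25)%:E * mine 1 (sqdist (pullback g p alpha) x)
     <= mine 1 (sqdist alpha (S x)))%E.
Proof.
move=> hS far.
have h25 (u v : \bar R) : (u <= v -> (1 / 25)%:E * u <= (1 / 25)%:E * v)%E.
  by apply: lee_wpmul2l; rewrite lee_fin; lra.
have h1 : ((1 / 25)%:E * mine 1 (sqdist (pullback g p alpha) x)
     <= (1 / 25)%:E)%E.
  by rewrite -[leRHS]mule1; apply: h25; rewrite ge_min lexx.
rewrite le_min; apply/andP; split.
  by apply: (le_trans h1); rewrite lee_fin; lra.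
apply: le_sqdist => b bal; have [pb|npb] := boolP (p b); last first.
  by apply: (le_trans h1); rewrite lee_fin; exact: far.
rewrite hS (EFinM (1 / 25)); apply: h25.
rewrite ge_min; apply/orP; right; apply: sqdist_le.
by apply: in_imfset => /=; rewrite !inE /= bal.
Qed.

End Similarities.

Section ScaledIntegral.
Context {R : realType}.
Variables (mu : probability (measurableTypeR R) R) (A : set (measurableTypeR R)).
Hypotheses (mA : measurable A) (muA : mu (~` A) = 0%E).
Variables (f g : measurableTypeR R -> \bar R) (r : R).
Hypotheses (mf : measurable_fun setT f) (mg : measurable_fun setT g).
Hypotheses (f0 : (forall x, 0 <= f x)%E) (g0 : (forall x, 0 <= g x)%E).
Hypothesis (r0 : 0 <= r).

Lemma scaled_integral_le : (forall x, A x -> r%:E * f x <= g x)%E ->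
  (r%:E * \int[mu]_x f x <= \int[mu]_x g x)%E.
Proof.
move=> fg; rewrite -ge0_integralZl_EFin//.
apply: (le_integral_carried mu A) => //.
- exact: measurable_funeM.
- by move=> x; apply: mule_ge0; rewrite ?lee_fin.
Qed.

Lemma le_scaled_integral : (forall x, A x -> g x <= r%:E * f x)%E ->
  (\int[mu]_x g x <= r%:E * \int[mu]_x f x)%E.
Proof.
move=> fg; rewrite -ge0_integralZl_EFin//.
apply: (le_integral_carried mu A) => //.
- exact: measurable_funeM.
- by move=> x; apply: mule_ge0; rewrite ?lee_fin.
Qed.
End ScaledIntegral.

Section Estimates.
Context {R : realType}.
Variables (nu P : probability (measurableTypeR R) R).
Hypothesis hnu : is_dyadic_discrete nu.
Hypothesis hP : is_condensation_measure nu P.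
Implicit Types (alpha beta : {fset R}) (a b x y r : R).

Let carP := condensation_carried nu P hP hnu.
Let mI := @measurable_unit_itv R.

Lemma measurable_sqdist_comp alpha (S : measurableTypeR R -> measurableTypeR R) :
  measurable_fun setT S ->
  measurable_fun setT (fun x : measurableTypeR R => sqdist alpha (S x)).
Proof. exact: (measurableT_comp (measurable_sqdist alpha)). Qed.

Definition truncated_distortion alpha : \bar R :=
  (\int[P]_x mine 1 (sqdist alpha x))%E.

Lemma measurable_truncated alpha :
  measurable_fun setT (fun x : measurableTypeR R => mine 1%E (sqdist alpha x)).
Proof. by apply: measurable_mine => //; exact: measurable_sqdist. Qed.

Lemma measurable_truncated_comp alpha
    (S : measurableTypeR R -> measurableTypeR R) :
  measurable_fun setT S ->
  measurable_fun setT (fun x : measurableTypeR R => mine 1%E (sqdist alpha (S x))).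
Proof. exact: (measurableT_comp (measurable_truncated alpha)). Qed.

Lemma truncated_ge0 alpha x : (0 <= mine 1 (sqdist alpha x))%E.
Proof. by rewrite le_min sqdist_ge0 lee_fin ler01. Qed.

(** The cut at 1/2 is at distance at least 3/10 from both copies of P, and
    9/100 >= 1/25; the part of nu is bounded below by 0. *)
Lemma truncated_distortion_split alpha :
  ((1 / 75)%:E * truncated_distortion (pullback S1inv (fun b => b <= 1 / 2)%R alpha)
   + (1 / 75)%:E *
       truncated_distortion (pullback S2inv (fun b => ~~ (b <= 1 / 2))%R alpha)
   <= truncated_distortion alpha)%E.
Proof.
rewrite [leRHS](integral_condensation nu P hP); last 2 first.
- exact: measurable_truncated.
- by move=> x; exact: truncated_ge0.
rewrite (_ : 1 / 75 = 1 / 3 * (1 / 25)); last by field.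
rewrite EFinM -!muleA.
apply: (@le_trans _ _ ((1 / 3)%:E * \int[P]_x mine 1 (sqdist alpha (S1 x))
    + (1 / 3)%:E * \int[P]_x mine 1 (sqdist alpha (S2 x)))%E); last first.
  apply: leeDl; apply: mule_ge0; first by rewrite lee_fin; lra.
  by apply: integral_ge0 => x _; exact: truncated_ge0.
apply: leeD; (apply: lee_wpmul2l; first by rewrite lee_fin; lra).
- apply: (scaled_integral_le P _ mI carP) => //; try lra.
  + exact: measurable_truncated.
  + by apply: measurable_truncated_comp; exact: measurable_S1.
  + by move=> x; exact: truncated_ge0.
  + by move=> x; exact: truncated_ge0.
  move=> x /unit_itvP x01; apply: truncated_sqdist_pullback => [|b].
    exact: S1_sqr.
  by rewrite -ltNge /S1 => hb; nra.
- apply: (scaled_integral_le P _ mI carP) => //; try lra.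
  + exact: measurable_truncated.
  + by apply: measurable_truncated_comp; exact: measurable_S2.
  + by move=> x; exact: truncated_ge0.
  + by move=> x; exact: truncated_ge0.
  move=> x /unit_itvP x01; apply: truncated_sqdist_pullback => [|b].
    exact: S2_sqr.
  by rewrite negbK /S2 => hb; nra.
Qed.

(** At depth k, P contains 2^k copies of itself that each contribute 75^-k if
    nothing serves them, and one codebook point serves at most one copy. The
    linear form of the bound lets the induction distribute the points over the
    two halves without knowing how many go to each. *)
Lemma truncated_distortion_ge k alpha :
  ((1 / 75 ^+ k * (2 ^+ k - #|` alpha|%:R))%:E <= truncated_distortion alpha)%E.
Proof.
elim: k alpha => [|k IH] alpha.
  rewrite !expr0; case: (posnP #|` alpha|) => [a0|a0].
    rewrite a0 (cardfs0_eq a0) subr0 divr1 mulr1 /truncated_distortion.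
    under eq_integral => x _ do rewrite /sqdist big_seq_fset0 miney.
    by rewrite integral_cst// mul1e [leRHS]probability_setT.
  apply: (@le_trans _ _ 0%E); last first.
    by apply: integral_ge0 => x _; exact: truncated_ge0.
  rewrite lee_fin divr1 mul1r subr_le0.
  by rewrite -[1]/(1%:R) ler_nat.
apply: le_trans (truncated_distortion_split alpha).
set p := fun b : R => b <= 1 / 2.
have c1 := card_pullback S1inv p alpha.
have c2 := card_pullback S2inv (fun b => ~~ p b) alpha.
apply: (@le_trans _ _ ((1 / 75)%:E *
   (1 / 75 ^+ k * (2 ^+ k - #|` pullback S1inv p alpha|%:R))%:E +
   (1 / 75)%:E * (1 / 75 ^+ k *
     (2 ^+ k - #|` pullback S2inv (fun b => ~~ p b) alpha|%:R))%:E)%E).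
  rewrite -!EFinM -EFinD lee_fin.
  have := card_fset_filterC alpha p.
  set n1 := #|` pullback _ _ _| in c1 *; set n2 := #|` pullback _ _ _| in c2 *.
  set m1 := #|` _| in c1 *; set m2 := #|` _| in c2 *.
  move=> m12; have : (n1 + n2 <= #|` alpha|)%N by lia.
  rewrite -(ler_nat R) natrD => n12.
  have k0 : 0 < 1 / 75 ^+ k :> R by rewrite divr_gt0// exprn_gt0.
  rewrite !exprS (_ : 1 / (75 * 75 ^+ k) = 1 / 75 * (1 / 75 ^+ k)); last first.
    by field; rewrite expf_neq0.
  set q := 1 / 75 ^+ k in k0 *; set K := 2 ^+ k.
  nra.
by apply: leeD; apply: lee_wpmul2l => //; rewrite lee_fin; lra.
Qed.

Lemma truncated_distortion_le alpha :
  (truncated_distortion alpha <= distortion P alpha)%E.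
Proof.
apply: ge0_le_integral => //.
- by move=> x _; exact: truncated_ge0.
- exact: measurable_truncated.
- exact: measurable_sqdist.
- by move=> x _; rewrite ge_min lexx orbT.
Qed.

Lemma distortion_ge k alpha :
  ((1 / 75 ^+ k * (2 ^+ k - #|` alpha|%:R))%:E <= distortion P alpha)%E.
Proof.
exact: le_trans (truncated_distortion_ge k alpha) (truncated_distortion_le alpha).
Qed.

Definition assemble alpha1 alpha2 beta : {fset R} :=
  ((@S1 R) @` alpha1 `|` (@S2 R) @` alpha2 `|` beta)%fset.

Lemma card_assemble alpha1 alpha2 beta :
  (#|` assemble alpha1 alpha2 beta| <= #|` alpha1| + #|` alpha2| + #|` beta|)%N.
Proof.
apply: leq_trans (leq_card_fsetU _ _) _; rewrite leq_add2r.
apply: leq_trans (leq_card_fsetU _ _) _.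
by apply: leq_add; exact: leq_imfset_card.
Qed.

(** No point of the codebook needs to be discarded here, so these bounds hold at
    every x, including those outside the supports. *)
Lemma sqdist_assemble alpha1 alpha2 beta x :
  [/\ (sqdist (assemble alpha1 alpha2 beta) (S1 x) <= (1 / 25)%:E * sqdist alpha1 x)%E,
      (sqdist (assemble alpha1 alpha2 beta) (S2 x) <= (1 / 25)%:E * sqdist alpha2 x)%E
    & (sqdist (assemble alpha1 alpha2 beta) x <= sqdist beta x)%E].
Proof.
have h25 (u v : \bar R) : (25%:E * u <= v -> u <= (1 / 25)%:E * v)%E.
  by rewrite div1r lee_pdivlMl// muleC.
split.
- apply: h25; apply: sqdist_comparison => // b bal.
  exists (S1 b); first by rewrite !inE in_imfset.
  by rewrite S1_sqr /S1inv /S1; lra.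
- apply: h25; apply: sqdist_comparison => // b bal.
  exists (S2 b); first by rewrite !inE in_imfset// orbT.
  by rewrite S2_sqr /S2inv /S2; nra.
- rewrite -[leLHS]mul1e; apply: sqdist_comparison => // b bal.
  by exists b; rewrite ?mul1r// !inE bal orbT.
Qed.

Lemma distortion_assemble alpha1 alpha2 beta :
  (distortion P (assemble alpha1 alpha2 beta)
    <= (1 / 75)%:E * distortion P alpha1 + (1 / 75)%:E * distortion P alpha2
       + (1 / 3)%:E * distortion nu beta)%E.
Proof.
rewrite distortionE [leLHS](integral_condensation nu P hP); last 2 first.
- exact: measurable_sqdist.
- by move=> x; exact: sqdist_ge0.
rewrite (_ : 1 / 75 = 1 / 3 * (1 / 25)); last by field.
rewrite (EFinM (1 / 3)) -!muleA.
have [mS1 mS2] := (@measurable_S1 R, @measurable_S2 R).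
apply: leeD; first apply: leeD; (apply: lee_wpmul2l; first by rewrite lee_fin; lra).
- apply: (le_scaled_integral P _ mI carP) => //; try lra.
  + exact: measurable_sqdist.
  + exact: measurable_sqdist_comp.
  + by move=> x; exact: sqdist_ge0.
  + by move=> x; exact: sqdist_ge0.
  + by move=> x _; have [] := sqdist_assemble alpha1 alpha2 beta x.
- apply: (le_scaled_integral P _ mI carP) => //; try lra.
  + exact: measurable_sqdist.
  + exact: measurable_sqdist_comp.
  + by move=> x; exact: sqdist_ge0.
  + by move=> x; exact: sqdist_ge0.
  + by move=> x _; have [] := sqdist_assemble alpha1 alpha2 beta x.
- apply: ge0_le_integral => //.
  + by move=> x _; exact: sqdist_ge0.
  + exact: measurable_sqdist.
  + exact: measurable_sqdist.
  + by move=> x _; have [] := sqdist_assemble alpha1 alpha2 beta x.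
Qed.

End Estimates.

(** * Codebooks of small distortion split *)

Section Separation.
Context {R : realType}.
Variables (nu P : probability (measurableTypeR R) R).
Hypothesis hnu : is_dyadic_discrete nu.
Hypothesis hP : is_condensation_measure nu P.
Implicit Types (alpha beta : {fset R}) (a b x y r w : R).

Let carP := condensation_carried nu P hP hnu.
Let mI := @measurable_unit_itv R.

Lemma mass_unit_itv : P unit_itv = 1%E.
Proof.
have := probability_setC P (measurableC mI).
by rewrite setCK carP sube0.
Qed.

Let third_ge0 (mu : probability (measurableTypeR R) R) A :
  (0 <= (1 / 3)%:E * mu A)%E.
Proof. by apply: mule_ge0; [rewrite lee_fin; lra|exact: measure_ge0]. Qed.

(** A lower bound for a mass propagates along the defining equation by keeping
    one of its three terms. *)
Lemma mass_S1 (A B : set (measurableTypeR R)) w :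
  measurable A -> measurable B -> A `<=` @S1 R @^-1` B ->
  (w%:E <= P A)%E -> ((1 / 3 * w)%:E <= P B)%E.
Proof.
move=> mA mB AB wA; rewrite [leRHS](hP _ mB) -addeA.
apply: (@le_trans _ _ ((1 / 3)%:E * pushforward P (@S1 R) B)%E); last first.
  by apply: leeDl; apply: adde_ge0; exact: third_ge0.
rewrite EFinM; apply: lee_wpmul2l; first by rewrite lee_fin; lra.
apply: (le_trans wA); apply: le_measure; rewrite ?inE//.
by rewrite -[X in measurable X]setTI; exact: measurable_S1.
Qed.

Lemma mass_S2 (A B : set (measurableTypeR R)) w :
  measurable A -> measurable B -> A `<=` @S2 R @^-1` B ->
  (w%:E <= P A)%E -> ((1 / 3 * w)%:E <= P B)%E.
Proof.
move=> mA mB AB wA; rewrite [leRHS](hP _ mB) addeAC addeC.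
apply: (@le_trans _ _ ((1 / 3)%:E * pushforward P (@S2 R) B)%E); last first.
  by apply: leeDl; apply: adde_ge0; exact: third_ge0.
rewrite EFinM; apply: lee_wpmul2l; first by rewrite lee_fin; lra.
apply: (le_trans wA); apply: le_measure; rewrite ?inE//.
by rewrite -[X in measurable X]setTI; exact: measurable_S2.
Qed.

Lemma mass_atom j : ((1 / 3 * 2 ^- j.+1)%:E <= P [set atom R j.+1])%E.
Proof.
have mB : measurable ([set atom R j.+1] : set (measurableTypeR R)).
  exact: measurable_set1.
rewrite [leRHS](hP _ mB) addeC.
apply: (@le_trans _ _ ((1 / 3)%:E * nu [set atom R j.+1])%E); last first.
  by apply: leeDl; apply: adde_ge0; exact: third_ge0.
by rewrite hnu// -EFinM.
Qed.

(** If the codebook misses ]lo, hi[, then every point of B is at distance at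
    least eta from it. *)
Lemma distortion_hit (B : set (measurableTypeR R)) alpha lo hi eta w :
  measurable B -> (forall x, B x -> lo + eta <= x <= hi - eta) -> 0 <= eta ->
  (w%:E <= P B)%E -> (distortion P alpha < (eta ^+ 2 * w)%:E)%E ->
  exists2 a, a \in alpha & lo < a < hi.
Proof.
move=> mB hB eta0 wB; apply: contraPP => nohit; apply/negP; rewrite -leNgt.
apply: (@le_trans _ _ ((eta ^+ 2)%:E * P B)%E).
  by rewrite EFinM; apply: lee_wpmul2l => //; rewrite lee_fin sqr_ge0.
apply: integral_ge_mass => //.
- exact: measurable_sqdist.
- by move=> x; exact: sqdist_ge0.
- exact: sqr_ge0.
move=> x /hB hx; apply: le_sqdist => a aal; rewrite lee_fin.
have : ~~ (lo < a < hi) by apply/negP => ha; apply: nohit; exists a.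
by rewrite negb_and -!leNgt => /orP[h|h]; nra.
Qed.

(** The four intervals are centred at the ends 1/5, 2/5, 3/5, 4/5 of the gaps
    between the three parts of P. Near each end P has a definite mass: 1/9 on
    [4/25, 1/5] and on [4/5, 21/25], 1/6 at the first atom 2/5 and 1/24 at the
    third atom 11/20. The last one gives the smallest bound, 1/9600. *)
Lemma good_alpha_hits alpha : (distortion P alpha < (1 / 10000)%:E)%E ->
  [/\ exists2 a, a \in alpha & 1 / 10 < a < 3 / 10,
      exists2 a, a \in alpha & 3 / 10 < a < 1 / 2,
      exists2 a, a \in alpha & 1 / 2 < a < 7 / 10
    & exists2 a, a \in alpha & 7 / 10 < a < 9 / 10].
Proof.
move=> small.
have lt_small c : 1 / 10000 <= c -> (distortion P alpha < c%:E)%E.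
  by move=> h; apply: (lt_le_trans small); rewrite lee_fin.
pose seg u v : set (measurableTypeR R) := `[u, v]%classic.
have mseg u v : measurable (seg u v) by exact: measurable_itv.
have segP u v x : seg u v x <-> u <= x <= v by rewrite /seg /= in_itv.
have unit1 : (1%:E <= P unit_itv)%E by rewrite mass_unit_itv.
have m45 : ((1 / 3 * 1)%:E <= P (seg (4 / 5)%R 1%R))%E.
  apply: (mass_S2 unit_itv) => // x /unit_itvP x01.
  by apply/segP; rewrite /S2; lra.
have m15 : ((1 / 3 * 1)%:E <= P (seg 0%R (1 / 5)%R))%E.
  apply: (mass_S1 unit_itv) => // x /unit_itvP x01.
  by apply/segP; rewrite /S1; lra.
split.
- apply: (distortion_hit (seg (4 / 25) (1 / 5)) _ _ _ (6 / 100)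
           (1 / 3 * (1 / 3 * 1))) => //; last by apply: lt_small; lra.
  + by move=> x /segP; lra.
  + apply: (mass_S1 (seg (4 / 5) 1)) => // x /segP hx.
    by apply/segP; rewrite /S1; lra.
- apply: (distortion_hit [set atom R 1] _ _ _ (1 / 10) (1 / 3 * 2 ^- 1)) => //.
  + by move=> x /= ->; rewrite atomE expr0; lra.
  + exact: mass_atom.
  + by apply: lt_small; lra.
- apply: (distortion_hit [set atom R 3] _ _ _ (1 / 20) (1 / 3 * 2 ^- 3)) => //.
  + by move=> x /= ->; rewrite atomE; lra.
  + exact: mass_atom.
  + by apply: lt_small; lra.
- apply: (distortion_hit (seg (4 / 5) (21 / 25)) _ _ _ (6 / 100)
           (1 / 3 * (1 / 3 * 1))) => //; last by apply: lt_small; lra.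
  + by move=> x /segP; lra.
  + apply: (mass_S2 (seg 0 (1 / 5))) => // x /segP hx.
    by apply/segP; rewrite /S2; lra.
Qed.

(** If x lies left of the midpoint u of ]lo, hi[ and b right of hi, then any
    point of ]lo, hi[ is at least as close to x as b is. *)
Lemma nearer_point_left alpha u b x lo hi :
  (exists2 a, a \in alpha & lo < a < hi) -> u = (lo + hi) / 2 ->
  x <= u -> hi <= b ->
  exists2 a, a \in alpha & lo < a < hi /\ (x - a) ^+ 2 <= (x - b) ^+ 2.
Proof.
move=> [a aal ha] uE xu hb; exists a => //; split=> //.
rewrite -subr_ge0 subr_sqr; nra.
Qed.

Lemma nearer_point_right alpha u b x lo hi :
  (exists2 a, a \in alpha & lo < a < hi) -> u = (lo + hi) / 2 ->
  u <= x -> b <= lo ->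
  exists2 a, a \in alpha & lo < a < hi /\ (x - a) ^+ 2 <= (x - b) ^+ 2.
Proof.
move=> [a aal ha] uE xu hb; exists a => //; split=> //.
rewrite -subr_ge0 subr_sqr; nra.
Qed.

Local Open Scope fset_scope.

(** Cutting at the midpoints 3/10 and 7/10 of the gaps loses nothing: around
    each end of a gap there is a codebook point, on its own side of the cut,
    that beats every point beyond the cut. *)
Lemma good_alpha_splits alpha : (distortion P alpha < (1 / 10000)%:E)%E ->
  exists alpha1 alpha2 beta, [/\ (0 < #|` alpha1|)%N, (0 < #|` alpha2|)%N,
    (0 < #|` beta|)%N, (#|` alpha1| + #|` alpha2| + #|` beta| <= #|` alpha|)%N
  & ((1 / 75)%:E * distortion P alpha1 + (1 / 75)%:E * distortion P alpha2
     + (1 / 3)%:E * distortion nu beta <= distortion P alpha)%E].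
Proof.
move=> /good_alpha_hits[hit1 hit2 hit3 hit4].
pose left b := b < 3 / 10; pose right b := 7 / 10 <= b.
pose beta := [fset b in [fset b in alpha | ~~ left b] | ~~ right b].
exists (pullback S1inv left alpha), (pullback S2inv right alpha), beta.
split.
- have [a aal ha] := hit1; rewrite cardfs_gt0; apply/fset0Pn.
  exists (S1inv a); apply: in_imfset; rewrite /= !inE /= aal /left; lra.
- have [a aal ha] := hit4; rewrite cardfs_gt0; apply/fset0Pn.
  exists (S2inv a); apply: in_imfset; rewrite /= !inE /= aal /right; lra.
- have [a aal ha] := hit2; rewrite cardfs_gt0; apply/fset0Pn.
  by exists a; rewrite !inE /= aal /left /right /=; lra.
- have c1 := card_pullback S1inv left alpha.
  have c2 := card_pullback S2inv right alpha.
  have c3 := card_fset_filterC alpha left.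
  have := card_fset_filterC [fset b in alpha | ~~ left b] right.
  rewrite (_ : [fset b in [fset b in alpha | ~~ left b] | right b]
     = [fset b in alpha | right b]); first by rewrite -/beta; lia.
  apply/fsetP => b; rewrite !inE /= -andbA; congr andb.
  by rewrite /left /right; lra.
rewrite [leRHS]distortionE [leRHS](integral_condensation nu P hP); last 2 first.
- exact: measurable_sqdist.
- by move=> x; exact: sqdist_ge0.
rewrite (_ : 1 / 75 = 1 / 3 * (1 / 25)); last by field.
rewrite (EFinM (1 / 3)) -!muleA.
have [mS1 mS2] := (@measurable_S1 R, @measurable_S2 R).
apply: leeD; first apply: leeD; (apply: lee_wpmul2l; first by rewrite lee_fin; lra).
- apply: (scaled_integral_le P _ mI carP) => //; try lra.
  + exact: measurable_sqdist.
  + exact: measurable_sqdist_comp.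
  + by move=> x; exact: sqdist_ge0.
  + by move=> x; exact: sqdist_ge0.
  move=> x /unit_itvP x01; apply: sqdist_pullback => [|b bal]; first exact: S1_sqr.
  rewrite /left -leNgt => hb.
  have [||| a aal [ha ab]] := nearer_point_left alpha (1 / 5) b (S1 x) _ _ hit1 => //.
  + by lra.
  + by rewrite /S1; lra.
  by exists a => //; split => //; lra.
- apply: (scaled_integral_le P _ mI carP) => //; try lra.
  + exact: measurable_sqdist.
  + exact: measurable_sqdist_comp.
  + by move=> x; exact: sqdist_ge0.
  + by move=> x; exact: sqdist_ge0.
  move=> x /unit_itvP x01; apply: sqdist_pullback => [|b bal]; first exact: S2_sqr.
  rewrite /right -ltNge => hb.
  have [||| a aal [ha ab]] := nearer_point_right alpha (4 / 5) b (S2 x) _ _ hit4 => //.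
  + by lra.
  + by rewrite /S2; lra.
  + by lra.
  by exists a => //; split => //; rewrite /right; lra.
- apply: (le_integral_carried nu _ _ _ measurable_atoms (nu_carried_atoms nu hnu)) => //.
  + exact: measurable_sqdist.
  + exact: measurable_sqdist.
  + by move=> x; exact: sqdist_ge0.
  + by move=> x; exact: sqdist_ge0.
  move=> x /atoms_bounds hx.
  rewrite -[leLHS]mul1e; apply: sqdist_comparison => // b bal.
  have [hb|hb] := boolP (left b).
    have [||| a aal [ha ab]] := nearer_point_right alpha (2 / 5) b x _ _ hit2 => //.
    + by lra.
    + by lra.
    + by move: hb; rewrite /left; lra.
    by exists a; rewrite ?mul1r// !inE /= aal /left /right; lra.
  have [hb'|hb'] := boolP (right b).
    have [||| a aal [ha ab]] := nearer_point_left alpha (3 / 5) b x _ _ hit3 => //.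
    + by lra.
    + by lra.
    by exists a; rewrite ?mul1r// !inE /= aal /left /right; lra.
  by exists b; rewrite ?mul1r// !inE /= bal hb hb'.
Qed.

End Separation.

(** * Real-valued quantization errors *)

Section RealError.
Context {R : realType}.
Variable mu : probability (measurableTypeR R) R.
Hypothesis mu1 : (distortion mu [fset 0%R]%fset <= 1)%E.
Implicit Types (alpha : {fset R}) (r e : R).

Definition qerr n : R := fine (quant_error mu n).

Lemma quant_error_le n alpha : (1 <= #|` alpha| <= n)%N ->
  (quant_error mu n <= distortion mu alpha)%E.
Proof. by move=> h; apply: ereal_inf_lbound; exists alpha. Qed.

Lemma quant_error_ge n (r : \bar R) :
  (forall alpha, (1 <= #|` alpha| <= n)%N -> r <= distortion mu alpha)%E ->
  (r <= quant_error mu n)%E.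
Proof. by move=> h; apply: le_ereal_inf_tmp => _ [alpha /= ha <-]; exact: h. Qed.

Lemma quant_errorE n : (0 < n)%N -> quant_error mu n = (qerr n)%:E.
Proof.
move=> n0; rewrite /qerr fineK// ge0_fin_numE; last first.
  by apply: quant_error_ge => alpha _; exact: distortion_ge0.
apply: (@le_lt_trans _ _ 1%E); last exact: ltry.
by apply: le_trans mu1; apply: quant_error_le; rewrite cardfs1.
Qed.

Lemma qerr_le n alpha : (1 <= #|` alpha| <= n)%N ->
  ((qerr n)%:E <= distortion mu alpha)%E.
Proof.
move=> h; rewrite -quant_errorE; first exact: quant_error_le.
by case/andP: h; exact: leq_trans.
Qed.

Lemma qerr_ge n r : (0 < n)%N ->
  (forall alpha, (1 <= #|` alpha| <= n)%N -> r%:E <= distortion mu alpha)%E ->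
  r <= qerr n.
Proof.
by move=> n0 h; rewrite -lee_fin -quant_errorE//; exact: quant_error_ge.
Qed.

Lemma qerr_ge0 n : (0 < n)%N -> 0 <= qerr n.
Proof. by move=> n0; apply: qerr_ge => // alpha _; exact: distortion_ge0. Qed.

Lemma qerr_le1 n : (0 < n)%N -> qerr n <= 1.
Proof.
by move=> n0; rewrite -lee_fin; apply: le_trans mu1; apply: qerr_le; rewrite cardfs1.
Qed.

Lemma qerr_near n e : (0 < n)%N -> 0 < e ->
  exists2 alpha, (1 <= #|` alpha| <= n)%N &
    (distortion mu alpha <= (qerr n + e)%:E)%E.
Proof.
move=> n0 e0; have fn : quant_error mu n \is a fin_num by rewrite quant_errorE.
have [_ [alpha ha <-] lt] := lb_ereal_inf_adherent e0 fn.
by exists alpha => //; rewrite EFinD -quant_errorE//; exact: ltW.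
Qed.

Lemma qerr_anti m n : (0 < m <= n)%N -> qerr n <= qerr m.
Proof.
move=> /andP[m0 mn]; apply: qerr_ge => // alpha /andP[a1 am].
by apply: qerr_le; rewrite a1 (leq_trans am).
Qed.

Lemma distortion_le1 (A : set (measurableTypeR R)) : measurable A ->
  mu (~` A) = 0%E -> (forall x, A x -> 0 <= x <= 1) ->
  (distortion mu [fset 0%R]%fset <= 1)%E.
Proof.
move=> mA muA A01; have -> : 1%E = (\int[mu]_x (cst 1%E) x)%E :> \bar R.
  by rewrite integral_cst// mul1e [RHS]probability_setT.
apply: (le_integral_carried mu A) => //.
- exact: measurable_sqdist.
- by move=> x; exact: sqdist_ge0.
move=> x /A01 x01; apply: le_trans (sqdist_le _ _ 0 _) _; first by rewrite inE.
by rewrite lee_fin; nra.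
Qed.

End RealError.

Section DyadicError.
Context {R : realType}.
Variable nu : probability (measurableTypeR R) R.
Hypothesis hnu : is_dyadic_discrete nu.

Lemma nu_distortion_le1 : (distortion nu [fset 0%R]%fset <= 1)%E.
Proof.
apply: (distortion_le1 nu _ measurable_atoms (nu_carried_atoms nu hnu)).
by move=> x /atoms_bounds; lra.
Qed.

(** Take the first m + 1 atoms as codebook: the others have total mass 2^-(m+1)
    and are within 2^-m / 5 of the last chosen one. *)
Lemma nu_qerr_le m : qerr nu m.+1 <= 8 ^- m.
Proof.
pose beta : {fset R} := [fset x in [seq atom R i.+1 | i <- iota 0 m.+1]]%fset.
have inbeta i : (i < m.+1)%N -> atom R i.+1 \in beta.
  move=> im; apply/imfsetP; exists (atom R i.+1) => //.
  by apply: (map_f (fun i => atom R i.+1)); rewrite mem_iota.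
have bm : (1 <= #|` beta| <= m.+1)%N.
  rewrite cardfs_gt0 card_fseq; apply/andP; split.
    by apply/fset0Pn; exists (atom R 1); exact: inbeta.
  by apply: (leq_trans (size_undup _)); rewrite size_map size_iota.
rewrite -lee_fin; apply: (le_trans (qerr_le nu nu_distortion_le1 _ _ bm)).
pose c : R := 4 ^- m; have c0 : 0 <= c by rewrite invr_ge0 exprn_ge0.
have mF := measurableC (@measurable_first_atoms R m.+1).
apply: (@le_trans _ _
    (\int[nu]_x (c%:E * (\1_(~` first_atoms m.+1) x)%:E))%E).
  apply: (le_integral_carried nu _ _ _ measurable_atoms
            (nu_carried_atoms nu hnu)).
  - exact: measurable_sqdist.
  - apply: measurable_funeM; apply/measurable_EFinP.
    exact: measurable_indic.
  - by move=> x; exact: sqdist_ge0.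
  - by move=> x; rewrite -EFinM lee_fin mulr_ge0.
  move=> x [k _ [j _ ->]]; rewrite indicE.
  have [jm|mj] := ltnP j m.+1.
    apply: le_trans (sqdist_le _ _ _ (inbeta _ jm)) _.
    by rewrite subrr expr0n -EFinM lee_fin mulr_ge0.
  rewrite mem_set; last first.
    move=> [i im /atom_inj ij]; rewrite -ij ltnNge in im.
    by rewrite mj in im.
  apply: le_trans (sqdist_le _ _ _ (inbeta m (ltnSn m))) _.
  rewrite -EFinM lee_fin mulr1.
  have := atom_bounds m j (ltnW mj) => /(_ R).
  have -> : c = (2 ^- m) ^+ 2 by rewrite /c exprVn -exprM mulnC exprM (_ : 2 ^+ 2 = 4)//; ring.
  rewrite (atomE m); have : 0 < 2 ^- m :> R by rewrite invr_gt0 exprn_gt0.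
  move: (2 ^- m) (atom R j.+1) => u v u0 huv; nra.
rewrite ge0_integralZl_EFin//; last first.
  by apply/measurable_EFinP; exact: measurable_indic.
rewrite integral_indic// setIT [X in (_ * X)%E](nu_other_atoms nu hnu).
rewrite -EFinM lee_fin /c (_ : 8 = 4 * 2); last by ring.
rewrite exprMn invfM; apply: ler_wpM2l => //.
by rewrite lef_pV2 ?posrE ?exprn_gt0// ler_eXn2l// ltr1n.
Qed.

End DyadicError.

Section CondensationError.
Context {R : realType}.
Variables (nu P : probability (measurableTypeR R) R).
Hypothesis hnu : is_dyadic_discrete nu.
Hypothesis hP : is_condensation_measure nu P.

Lemma P_distortion_le1 : (distortion P [fset 0%R]%fset <= 1)%E.
Proof.
apply: (distortion_le1 P _ measurable_unit_itv (condensation_carried nu P hP hnu)).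
by move=> x /unit_itvP.
Qed.

Let P1 := P_distortion_le1.
Let nu1 := nu_distortion_le1 nu hnu.

Lemma P_qerr_lower k n : (0 < n)%N ->
  1 / 75 ^+ k * (2 ^+ k - n%:R) <= qerr P n.
Proof.
move=> n0; apply: (qerr_ge P P1) => // alpha /andP[_ an].
apply: le_trans (distortion_ge nu P hnu hP k alpha); rewrite lee_fin.
apply: ler_wpM2l; first by rewrite divr_ge0// exprn_ge0.
by rewrite lerD2l lerN2 ler_nat.
Qed.

Lemma P_qerr_assemble n1 n2 m : (0 < n1)%N -> (0 < n2)%N -> (0 < m)%N ->
  qerr P (n1 + n2 + m) <= (qerr P n1 + qerr P n2) / 75 + qerr nu m / 3.
Proof.
move=> n10 n20 m0; apply/ler_addgt0Pr => e e0.
have [a1 /andP[a1l a1r] h1] := qerr_near P P1 n1 e n10 e0.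
have [a2 /andP[a2l a2r] h2] := qerr_near P P1 n2 e n20 e0.
have [b /andP[bl br] h3] := qerr_near nu nu1 m e m0 e0.
have g1 : (0 < #|` assemble a1 a2 b|)%N.
  rewrite cardfs_gt0; have : (0 < #|` b|)%N by [].
  rewrite cardfs_gt0 => /fset0Pn[x xb]; apply/fset0Pn; exists x.
  by rewrite !inE xb orbT.
have gn : (#|` assemble a1 a2 b| <= n1 + n2 + m)%N.
  by have := card_assemble a1 a2 b; lia.
have gb : (1 <= #|` assemble a1 a2 b| <= n1 + n2 + m)%N by rewrite g1.
have le1 := qerr_le P P1 _ _ gb.
have le2 := distortion_assemble nu P hnu hP a1 a2 b.
have : ((qerr P (n1 + n2 + m))%:E <= (1 / 75)%:E * (qerr P n1 + e)%:E
   + (1 / 75)%:E * (qerr P n2 + e)%:E + (1 / 3)%:E * (qerr nu m + e)%:E)%E.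
  apply: (le_trans le1); apply: (le_trans le2).
  by apply: leeD; first apply: leeD; apply: lee_wpmul2l => //; rewrite lee_fin; lra.
rewrite -!EFinM -!EFinD lee_fin; lra.
Qed.

(** Together with [P_qerr_assemble], this computes small errors exactly. It is
    stated for a lower bound r of all the splittings because an optimal
    codebook is not at hand, only nearly optimal ones. *)
Lemma P_qerr_split N r : (0 < N)%N -> r <= 1 / 10000 ->
  (forall n1 n2 m, (0 < n1)%N -> (0 < n2)%N -> (0 < m)%N -> (n1 + n2 + m <= N)%N ->
     r <= (qerr P n1 + qerr P n2) / 75 + qerr nu m / 3) ->
  r <= qerr P N.
Proof.
move=> N0 r0 h; apply: (qerr_ge P P1) => // alpha /andP[a1 aN].
have [big|small] := leP (1 / 10000)%:E (distortion P alpha).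
  by apply: le_trans big; rewrite lee_fin.
have [b1 [b2 [b [b10 b20 b0 cb le]]]] :=
  good_alpha_splits nu P hnu hP alpha small.
have := h _ _ _ b10 b20 b0 (leq_trans cb aN); rewrite -lee_fin.
move=> h'; apply: le_trans le; apply: (le_trans h').
have q1 := qerr_le P P1 #|` b1| b1; have q2 := qerr_le P P1 #|` b2| b2.
have q3 := qerr_le nu nu1 #|` b| b.
rewrite (_ : (_ + _) / 75 + _ / 3 = 1 / 75 * qerr P #|` b1| +
  1 / 75 * qerr P #|` b2| + 1 / 3 * qerr nu #|` b|); last by field.
rewrite 2!EFinD !(EFinM (1 / _)).
by apply: leeD; first apply: leeD; apply: lee_wpmul2l;
  rewrite ?lee_fin ?divr_ge0// ?q1 ?q2 ?q3 ?b10 ?b20 ?b0 ?leqnn.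
Qed.

End CondensationError.

(** * Penalized minimizers *)

Section Minimizers.
Context {R : realType}.
Implicit Types (U : nat -> R) (lam : R).

(** A line of slope -lam supports the graph of U at n: such n are the vertices,
    and possibly other points, of the lower convex hull of the graph. *)
Definition penalized_min U lam n :=
  (0 < n)%N /\ forall m, (0 < m)%N -> U n + lam * n%:R <= U m + lam * m%:R.

(** Beyond (U 1 + lam) / lam the penalty alone exceeds the value at 1. *)
Lemma penalized_min_exists U lam : (forall n, (0 < n)%N -> 0 <= U n) -> 0 < lam ->
  exists n, penalized_min U lam n.
Proof.
move=> U0 lam0; pose F n := U n.+1 + lam * n.+1%:R.
have [M hM] : exists M, forall n, (M <= n)%N -> F 0%N <= F n.
  have [M MM] : exists M, F 0%N / lam <= M%:R.
    exists (Num.truncn (F 0%N / lam)).+1; apply: ltW; apply: truncnS_gt.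
  exists M => n Mn; rewrite /F.
  have : M%:R <= n.+1%:R :> R by rewrite ler_nat; exact: leqW.
  have := U0 n.+1 isT; rewrite ler_pdivrMr// in MM.
  rewrite /F in MM *; nra.
(* The search is shifted by one: index i stands for size i + 1. *)
pose i := [arg min_(i < ord0 : 'I_M.+1) F i]%O.
have hi n : F i <= F n.
  rewrite /i; case: arg_minP => // j _ hj.
  have [nM|Mn] := ltnP n M.+1; first exact: (hj (Ordinal nM)).
  by apply: (le_trans (hj ord0 isT)); apply: hM; exact: ltnW.
exists i.+1; split => // -[//|m] _; exact: hi.
Qed.

(** Starting from a minimizer n for lam, lower the price until a larger size
    becomes as good: this happens at the largest slope (U n - U m) / (m - n)
    over m > n. Lower prices do not help the sizes below n. *)
Lemma penalized_min_kink U lam : (forall n, (0 < n)%N -> 0 <= U n) ->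
  (forall n, (0 < n)%N -> exists2 m, (n < m)%N & U m < U n) -> 0 < lam ->
  exists kink n d, [/\ 0 < kink <= lam, (0 < d)%N, penalized_min U kink n
    & penalized_min U kink (n + d)].
Proof.
move=> U0 dec lam0; have [n [n0 nmin]] := penalized_min_exists _ _ U0 lam0.
have [m nm Um] := dec n n0.
pose F i := (U n - U (n + i.+1)%N) / i.+1%:R.
have Fpos i : (0 : R) < i.+1%:R by rewrite ltr0n.
pose i0 := (m - n.+1)%N.
have Fi0 : 0 < F i0.
  by rewrite /F divr_gt0 ?subr_gt0// /i0 (_ : (n + _)%N = m)//; lia.
have [M hM] : exists M, forall i, (M <= i)%N -> F i <= F i0.
  exists (Num.truncn (U n / F i0)).+1 => i Mi.
  rewrite {1}/F ler_pdivrMr//.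
  have h1 : U n / F i0 < i.+1%:R.
    apply: lt_le_trans (truncnS_gt _) _; rewrite ler_nat; exact: leqW.
  have : 0 <= U (n + i.+1)%N by apply: U0; rewrite addnS.
  by rewrite ltr_pdivrMr// in h1; rewrite mulrC in h1; lra.
pose i : nat := [arg max_(j > ord_max : 'I_(maxn M i0).+1) F j]%O.
have hi j : F j <= F i.
  rewrite /i; case: arg_maxP => // u _ hu.
  have ui0 : F i0 <= F u.
    have i0M : (i0 < (maxn M i0).+1)%N by rewrite ltnS leq_maxr.
    exact: (hu (Ordinal i0M)).
  have [jM|Mj] := ltnP j (maxn M i0).+1; first exact: (hu (Ordinal jM)).
  apply: (le_trans _ ui0); apply: hM; apply: ltnW; apply: leq_trans Mj.
  by rewrite ltnS leq_maxl.
have Fi : 0 < F i by apply: lt_le_trans Fi0 (hi _).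
have slope : U n - U (n + i.+1)%N = F i * i.+1%:R by rewrite /F divfK ?gt_eqF.
have Fl : F i <= lam.
  rewrite /F ler_pdivrMr//; have := nmin (n + i.+1)%N; rewrite natrD mulrDr.
  by rewrite addn_gt0 n0 => /(_ isT); lra.
have minn : penalized_min U (F i) n.
  split=> // k k0; have [kn|nk|->//] := ltngtP k n.
    have : k%:R <= n%:R :> R by rewrite ler_nat ltnW.
    have := nmin k k0; nra.
  have -> : k = (n + (k - n.+1).+1)%N by lia.
  have := hi (k - n.+1)%N; rewrite {1}/F ler_pdivrMr// natrD; lra.
exists (F i), n, i.+1; split => //; first by rewrite Fi.
split=> [|k k0]; first by rewrite addn_gt0 n0.
by have := minn.2 k k0; rewrite natrD; lra.
Qed.

End Minimizers.

(** * Consequences of the recursion *)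

Section Recursion.
Context {R : realType}.
Variables (V W : nat -> R).
Hypothesis V_ge0 : forall n, (0 < n)%N -> 0 <= V n.
Hypothesis V_le1 : forall n, (0 < n)%N -> V n <= 1.
Hypothesis V_anti : forall m n, (0 < m <= n)%N -> V n <= V m.
Hypothesis V_lower : forall k n, (0 < n)%N ->
  1 / 75 ^+ k * (2 ^+ k - n%:R) <= V n.
Hypothesis W_ge0 : forall n, (0 < n)%N -> 0 <= W n.
Hypothesis W_upper : forall m, W m.+1 <= 8 ^- m.
Hypothesis V_assemble : forall n1 n2 m, (0 < n1)%N -> (0 < n2)%N -> (0 < m)%N ->
  V (n1 + n2 + m)%N <= (V n1 + V n2) / 75 + W m / 3.

(** Go from n to 2 n + 2 k + 2 points, with 2 k + 2 of them for nu: the error of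
    nu, at most 64^-k / 8, is then negligible against (2/75)^k. *)
Lemma error_upper k : V (5 * 2 ^ k)%N <= 5 * (2 / 75) ^+ k.
Proof.
(* n (k + 1) = 2 n k + 2 k + 2 and n 0 = 1 give n k = 5 * 2^k - 2 k - 4. *)
have [n [nk n0 nup]] : exists n, [/\ (n + 2 * k + 4 = 5 * 2 ^ k)%N, (0 < n)%N
    & V n <= 5 * (2 / 75) ^+ k - 4 * (1 / 64) ^+ k].
  elim: k => [|k [n [nk n0 nup]]].
    by exists 1%N; rewrite !expr0; split => //; have := V_le1 1%N isT; lra.
  (* The induction step needs 4 * (2/75 - 1/64) >= 1/24, where 1/24 bounds the
     contribution of nu divided by 64^-k; then 5 = 1 + 4 starts it. *)
  exists (n + n + (2 * k).+2)%N; split; [rewrite expnS; lia|lia|].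
  apply: le_trans (V_assemble _ _ _ n0 n0 _) _ => //.
  have := W_upper (2 * k).+1.
  have -> : 8 ^- (2 * k).+1 = 1 / 8 * (1 / 64) ^+ k :> R.
    rewrite exprS exprM invfM (_ : (8 : R) ^+ 2 = 64); last by ring.
    by rewrite !div1r exprVn.
  have h0 : 0 <= (1 / 64 : R) ^+ k by rewrite exprn_ge0.
  rewrite !exprS; lra.
apply: (@le_trans _ _ (V n)); first by apply: V_anti; rewrite n0 /=; lia.
by apply: (le_trans nup); rewrite gerBl mulr_ge0// exprn_ge0.
Qed.

Lemma error_decreases n : (0 < n)%N -> exists2 m, (n < m)%N & V m < V n.
Proof.
move=> n0.
have Vn : 0 < V n.
  apply: lt_le_trans (V_lower n n n0); rewrite mulr_gt0 ?divr_gt0 ?exprn_gt0//.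
  by rewrite subr_gt0 -natrX ltr_nat ltn_expl.
have : (fun k => (5 : R) * (2 / 75) ^+ k) @ \oo --> (5 * 0 : R).
  by apply: cvgMr; apply: cvg_expr; rewrite ger0_norm; lra.
rewrite mulr0 => /cvgr0Pnorm_lt /(_ _ Vn)[k _ hk].
exists (5 * 2 ^ (k + n))%N.
  by have := ltn_expl (k + n) (ltnSn 1); lia.
apply: le_lt_trans (error_upper _) _; apply: le_lt_trans (hk (k + n)%N _).
  exact: ler_norm.
exact: leq_addr.
Qed.

Variable eps0 : R.
Hypothesis eps0_gt0 : 0 < eps0.
Hypothesis V_split : forall N r, (0 < N)%N -> r <= eps0 ->
  (forall n1 n2 m, (0 < n1)%N -> (0 < n2)%N -> (0 < m)%N ->
     (n1 + n2 + m <= N)%N -> r <= (V n1 + V n2) / 75 + W m / 3) ->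
  r <= V N.

(** A price so low that some splitting costs less than eps0 in total. *)
Lemma recursion_small : exists2 lam0, 0 < lam0 & exists p s,
  [/\ (0 < p)%N, (0 < s)%N & forall lam, 0 < lam <= lam0 ->
  (V p + V p) / 75 + W s / 3 + lam * (p + p + s)%:R <= eps0].
Proof.
have c1 : (fun k => (5 : R) * (2 / 75) ^+ k) @ \oo --> (5 * 0 : R).
  by apply: cvgMr; apply: cvg_expr; rewrite ger0_norm; lra.
have c2 : (fun k => (8^-1 : R) ^+ k) @ \oo --> (0 : R).
  by apply: cvg_expr; rewrite ger0_norm; lra.
pose e := eps0 / 10; have e0 : 0 < e by rewrite divr_gt0.
rewrite mulr0 in c1.
move/cvgr0Pnorm_lt : c1 => /(_ _ e0)[k1 _ hk1].
move/cvgr0Pnorm_lt : c2 => /(_ _ e0)[k2 _ hk2].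
pose p := (5 * 2 ^ k1)%N.
have h1 : V p < e.
  apply: le_lt_trans (error_upper _) (le_lt_trans (ler_norm _) (hk1 k1 _)) => /=.
  exact: leqnn.
have h2 : W k2.+1 < e.
  apply: le_lt_trans (W_upper _) _; rewrite -exprVn.
  apply: le_lt_trans (ler_norm _) (hk2 k2 _) => /=; exact: leqnn.
have c0 : 0 < (p + p + k2.+1)%:R :> R by rewrite ltr0n addnS.
exists (eps0 / 2 / (p + p + k2.+1)%:R); first by rewrite !divr_gt0.
exists p, k2.+1; split => // [|lam /andP[lam0 lam1]].
  by rewrite /p muln_gt0 expn_gt0.
have : lam * (p + p + k2.+1)%:R <= eps0 / 2 by rewrite -ler_pdivlMr.
move: (lam * _) => X hX; rewrite /e in h1 h2; have := eps0_gt0; lra.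
Qed.

(** With a price on points, the three parts of P minimize independently, each at
    the price rescaled by its own factor 1/75 or 1/3. Sizes whose error exceeds
    eps0 do not obey the recursion, but they cost more than a splitting does
    when the price is low. *)
Lemma penalized_min_recursion : exists2 lam0, 0 < lam0 &
  forall lam n m, 0 < lam <= lam0 -> penalized_min V (75 * lam) n ->
    penalized_min W (3 * lam) m -> penalized_min V lam (n + n + m)%N.
Proof.
have [lam0 lam00 [p [s [p0 s0 small]]]] := recursion_small.
exists lam0 => // lam n m hlam [n0 nmin] [m0 mmin].
split=> [|N N0]; first by rewrite !addn_gt0 n0.
set r := V n / 75 + lam * n%:R + (V n / 75 + lam * n%:R) + (W m / 3 + lam * m%:R).
apply: (@le_trans _ _ r).
  by have := V_assemble n n m n0 n0 m0; rewrite /r !natrD; lra.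
have rle n1 n2 m1 : (0 < n1)%N -> (0 < n2)%N -> (0 < m1)%N ->
    r <= (V n1 + V n2) / 75 + W m1 / 3 + lam * (n1 + n2 + m1)%:R.
  move=> n10 n20 m10; have := nmin _ n10; have := nmin _ n20.
  by have := mmin _ m10; rewrite /r !natrD; lra.
have rsmall : r <= eps0 by apply: le_trans (rle p p s p0 p0 s0) (small _ hlam).
have [lampos _] := andP hlam.
have lamN : 0 <= lam * N%:R by rewrite mulr_ge0// ltW.
rewrite -lerBlDr; apply: V_split => //; first by lra.
move=> n1 n2 m1 n10 n20 m10 cN; have := rle _ _ _ n10 n20 m10.
have : lam * (n1 + n2 + m1)%:R <= lam * N%:R
  by apply: ler_wpM2l; rewrite ?ler_nat//; exact: ltW.
lra.
Qed.

(** A tie between n and n + d at price lam is copied by the recursion to a tie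
    at price lam / 75 between 2 n + m and 2 (n + d) + m, for the same m. The
    bound on N2 comes from comparing the minimizer N2 with 5 * 2^k points. *)
Lemma ties_at_all_scales : exists2 K : R, 0 < K & forall k, exists lam N1 N2,
  [/\ penalized_min V lam N1, penalized_min V lam N2, (2 ^ k <= N1)%N,
      (exists2 d, (0 < d)%N & N2 = (N1 + 2 ^ k * d)%N) & N2%:R <= K * 2 ^+ k].
Proof.
have [lam0 lam00 rec] := penalized_min_recursion.
have [lam [n [d [/andP[lpos llam0] d0 min1 min2]]]] :=
  penalized_min_kink V lam0 V_ge0 error_decreases lam00.
exists (5 / lam + 5); first by rewrite addr_gt0// divr_gt0.
have ties k : exists N, [/\ (2 ^ k <= N)%N, penalized_min V (lam / 75 ^+ k) N
    & penalized_min V (lam / 75 ^+ k) (N + 2 ^ k * d)].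
  elim: k => [|k [N [kN Nmin Nmin']]].
    exists n; rewrite expr0 divr1 expn0 mul1n; split => //; by case: min1.
  have p75 : 0 < 75 ^+ k.+1 :> R by rewrite exprn_gt0.
  have lk : lam / 75 ^+ k = 75 * (lam / 75 ^+ k.+1).
    by rewrite exprS; field; rewrite expf_neq0.
  have lk0 : 0 < lam / 75 ^+ k.+1 by rewrite divr_gt0.
  have lkle : 0 < lam / 75 ^+ k.+1 <= lam0.
    rewrite lk0 /= ler_pdivrMr//; apply: (le_trans llam0).
    by apply: ler_peMr; [exact: ltW|rewrite exprn_ege1// ler1n].
  have [m mmin] := penalized_min_exists W (3 * (lam / 75 ^+ k.+1)) W_ge0
    (mulr_gt0 (ltr0Sn R 2) lk0).
  rewrite lk in Nmin Nmin'.
  exists (N + N + m)%N; split; first by rewrite expnS; lia.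
    exact: rec.
  rewrite (_ : (N + N + m + 2 ^ k.+1 * d)%N =
    ((N + 2 ^ k * d) + (N + 2 ^ k * d) + m)%N); last by rewrite expnS; lia.
  exact: rec.
move=> k; have [N [kN min1k min2k]] := ties k.
exists (lam / 75 ^+ k), N, (N + 2 ^ k * d)%N; split => //; first by exists d.
have k0 : (0 < 5 * 2 ^ k)%N by rewrite muln_gt0 expn_gt0.
have := min2k.2 _ k0; have := V_ge0 _ min2k.1; have := error_upper k.
set X := (N + _)%:R; rewrite natrM natrX expr_div_n.
have p75 : 0 < 75 ^+ k :> R by rewrite exprn_gt0.
have p2 : 0 < 2 ^+ k :> R by rewrite exprn_gt0.
move: (75 ^+ k : R) (2 ^+ k : R) p75 p2 => u v u0 v0 h1 h2 h3.
have h : lam / u * X <= 5 * (v / u) + lam / u * (5 * v) by lra.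
have : (lam / u * X) * (u / lam) <= (5 * (v / u) + lam / u * (5 * v)) * (u / lam).
  by rewrite ler_wpM2r// divr_ge0// ltW.
have -> : lam / u * X * (u / lam) = X by field; rewrite !gt_eqF.
by have -> : (5 * (v / u) + lam / u * (5 * v)) * (u / lam) = (5 / lam + 5) * v
  by field; rewrite !gt_eqF.
Qed.

End Recursion.

(** * Ties at all scales exclude a limit *)

Section TiesPreventLimit.
Context {R : realType}.
Implicit Types (V : nat -> R) (a : R).

(** The strict convexity of t |-> t^-a in a scale-invariant form, with an
    explicit gain: the arithmetic-geometric mean inequality for the powers
    bounds the right-hand side below by the power of the product. *)
Lemma powR_midpoint (x y a : R) : 0 < x -> 0 < y ->
  (((x + y) / 2) ^+ 2 / (x * y)) `^ (a / 2)
    <= ((((x + y) / 2) / x) `^ a + (((x + y) / 2) / y) `^ a) / 2.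
Proof.
move=> x0 y0; set m := (x + y) / 2.
have m0 : 0 < m by rewrite divr_gt0// addr_gt0.
have mx : 0 < m / x by rewrite divr_gt0.
have my : 0 < m / y by rewrite divr_gt0.
have -> : m ^+ 2 / (x * y) = (m / x) * (m / y).
  by field; rewrite !gt_eqF.
rewrite (powRM _ (ltW mx) (ltW my)).
have sq z : 0 <= z -> z `^ a = (z `^ (a / 2)) ^+ 2.
  by move=> z0; rewrite -powR_mulrn ?powR_ge0// -powRrM divfK.
rewrite (sq _ (ltW mx)) (sq _ (ltW my)).
by move: ((m / x) `^ _) ((m / y) `^ _) => s t; have := sqr_ge0 (s - t); nra.
Qed.

(** At the midpoint m of N1 and N2, optimality of N1 and N2 for the same price
    gives V m >= (V N1 + V N2) / 2. If all three values were close to L n^-a,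
    this would contradict the convexity gain, which is bounded below because
    N2 - N1 >= 2^(M+1) while N1 and N2 are of order 2^M. *)
Lemma ties_prevent_limit V a (K L : R) : 0 < a -> 0 < K -> 0 < L ->
  (forall k, exists lam N1 N2,
     [/\ penalized_min V lam N1, penalized_min V lam N2, (2 ^ k <= N1)%N,
      (exists2 d, (0 < d)%N & N2 = (N1 + 2 ^ k * d)%N) & N2%:R <= K * 2 ^+ k]) ->
  (fun n => n%:R `^ a * V n) @ \oo --> L -> False.
Proof.
move=> a0 K0 L0 ties cvL.
pose eta := 1 / (4 * K ^+ 2).
have eta0 : 0 < eta by rewrite divr_gt0// mulr_gt0// exprn_gt0.
pose del := (1 + eta) `^ (a / 2) - 1.
have del0 : 0 < del.
  have a20 : 0 < a / 2 by rewrite divr_gt0.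
  have := gt0_ltr_powR a20; move=> /(_ 1 (1 + eta)).
  by rewrite !nnegrE powR1 /del; lra.
(* This tolerance makes (1 + del) (L - e) = L + e + L del / 2. *)
pose e := L * del / (2 * (2 + del)).
have den0 : 0 < 2 * (2 + del) by rewrite mulr_gt0// addr_gt0.
have e0 : 0 < e by rewrite divr_gt0// mulr_gt0.
move/cvgrPdist_lt : cvL => /(_ _ e0)[M _ hM].
have near_L n : (M <= n)%N -> L - e < n%:R `^ a * V n < L + e.
  by move=> Mn; have := hM n Mn; rewrite /= ltr_norml; lra.
have [lam [N1 [N2 [min1 min2 big [d d0 N2E] N2K]]]] := ties M.+1.
pose m := (N1 + 2 ^ M * d)%N.
have MN1 : (M <= N1)%N.
  by apply: leq_trans big; apply: ltnW; apply: ltn_trans (ltn_expl _ _).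
have Mm : (M <= m)%N by apply: leq_trans MN1 (leq_addr _ _).
have MN2 : (M <= N2)%N by rewrite N2E; apply: leq_trans MN1 (leq_addr _ _).
have mE : m%:R = (N1%:R + N2%:R) / 2 :> R.
  by rewrite N2E /m !natrD !natrM expnS natrM; field.
have x0 : 0 < N1%:R :> R by rewrite ltr0n; case: min1.
have y0 : 0 < N2%:R :> R by rewrite ltr0n; case: min2.
have m0 : 0 < m%:R :> R by rewrite mE divr_gt0// addr_gt0.
have Vm : (V N1 + V N2) / 2 <= V m.
  have mpos : (0 < m)%N by rewrite -(ltr0n R).
  have := min1.2 m mpos; have := min2.2 m mpos; rewrite mE; lra.
have gap : 1 + eta <= m%:R ^+ 2 / (N1%:R * N2%:R).
  rewrite ler_pdivlMr ?mulr_gt0//.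
  have N12 : N1%:R * N2%:R <= K ^+ 2 * 4 * (2 ^+ M) ^+ 2.
    have : N1%:R <= N2%:R :> R by rewrite ler_nat N2E leq_addr.
    move: N2K; rewrite exprS.
    have : 0 < 2 ^+ M :> R by rewrite exprn_gt0.
    move: (2 ^+ M) => P P0 h1 h2.
    apply: (@le_trans _ _ (N2%:R * N2%:R)); first by rewrite ler_wpM2r// ltW.
    apply: (@le_trans _ _ ((K * (2 * P)) * (K * (2 * P)))); last first.
      by rewrite le_eqVlt; apply/orP; left; apply/eqP; ring.
    by apply: ler_pM => //; exact: ltW.
  have dif : (2 ^+ M) ^+ 2 <= (N2%:R - N1%:R) ^+ 2 / 4 :> R.
    have -> : N2%:R - N1%:R = 2 * (2 ^+ M * d%:R) :> R.
      by rewrite N2E natrD natrM natrX exprS; ring.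
    rewrite exprMn (_ : 2 ^+ 2 = 4); last by ring.
    rewrite mulrC mulKf//; rewrite lerXn2r ?nnegrE ?mulr_ge0 ?exprn_ge0//.
    by rewrite ler_peMr ?exprn_ge0// ler1n.
  have sqE : m%:R ^+ 2 = N1%:R * N2%:R + (N2%:R - N1%:R) ^+ 2 / 4 :> R.
    by rewrite mE; field.
  rewrite sqE mulrDl mul1r lerD2l; apply: le_trans dif.
  rewrite /eta div1r mulrC ler_pdivrMr ?mulr_gt0 ?exprn_gt0//.
  by apply: (le_trans N12); rewrite [leRHS]mulrC (mulrC 4).
have ge1 : 1 + del <= ((m%:R / N1%:R) `^ a + (m%:R / N2%:R) `^ a) / 2.
  have := powR_midpoint _ _ a x0 y0; rewrite -mE; apply: le_trans.
  rewrite /del addrC subrK; apply: ge0_ler_powR => //.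
  - by rewrite divr_ge0// ltW.
  - by rewrite nnegrE addr_ge0// ltW.
  - by rewrite nnegrE divr_ge0 ?mulr_ge0// ltW.
have mN (N : nat) : 0 < (N%:R : R) ->
    m%:R `^ a * V N = (m%:R / N%:R) `^ a * (N%:R `^ a * V N).
  move=> N0; rewrite mulrA -powRM ?divr_ge0 ?ltW//.
  by rewrite divfK// gt_eqF.
have /andP[lo1 _] := near_L _ MN1; have /andP[lo2 _] := near_L _ MN2.
have /andP[_ him] := near_L _ Mm.
have Le : 0 < L - e.
  rewrite subr_gt0 /e ltr_pdivrMr//; nra.
have up : ((m%:R / N1%:R) `^ a + (m%:R / N2%:R) `^ a) / 2 * (L - e)
    <= m%:R `^ a * V m.
  apply: (@le_trans _ _ (m%:R `^ a * ((V N1 + V N2) / 2))); last first.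
    by apply: ler_wpM2l => //; exact: powR_ge0.
  have -> : m%:R `^ a * ((V N1 + V N2) / 2) =
      (m%:R `^ a * V N1 + m%:R `^ a * V N2) / 2 by field.
  rewrite (mN N1)// (mN N2)//.
  have := powR_ge0 (m%:R / N1%:R) a; have := powR_ge0 (m%:R / N2%:R) a.
  move: ((m%:R / N1%:R) `^ a) ((m%:R / N2%:R) `^ a) => u v.
  move: (N1%:R `^ a * V N1) (N2%:R `^ a * V N2) lo1 lo2 => y1 y2.
  nra.
have : (1 + del) * (L - e) < L + e.
  apply: le_lt_trans him; apply: le_trans up.
  by rewrite ler_wpM2r// ltW.
have : e * (2 * (2 + del)) = L * del.
  by rewrite /e divfK// gt_eqF.
nra.
Qed.

End TiesPreventLimit.

(** * Order of magnitude and quantization dimension *)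

Section Exponent.
Context {R : realType}.

(** This is 2 / D(P), chosen so that 2^a = 75 / 2. *)
Definition error_exponent : R := ln (75 / 2) / ln 2.

Lemma ln2_gt0 : 0 < ln 2 :> R.
Proof. by apply: ln_gt0; rewrite ltr1n. Qed.

Lemma error_exponent_gt0 : 0 < error_exponent.
Proof. by rewrite divr_gt0 ?ln2_gt0//; apply: ln_gt0; lra. Qed.

Lemma powR_error_exponent k : (2 ^+ k : R) `^ error_exponent = (75 / 2) ^+ k.
Proof.
have h : (2 : R) `^ error_exponent = 75 / 2.
  rewrite /powR ifF; last by apply/negbTE.
  by rewrite /error_exponent divfK ?gt_eqF ?ln2_gt0// lnK// posrE.
by rewrite -powR_mulrn// powRAC h powR_mulrn.
Qed.

Variable V : nat -> R.
Hypothesis V_le1 : forall n, (0 < n)%N -> V n <= 1.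
Hypothesis V_anti : forall m n, (0 < m <= n)%N -> V n <= V m.
Hypothesis V_lower : forall k n, (0 < n)%N ->
  1 / 75 ^+ k * (2 ^+ k - n%:R) <= V n.
Hypothesis V_upper : forall k, V (5 * 2 ^ k)%N <= 5 * (2 / 75) ^+ k.

(** For 2^k <= n < 2^(k+1), use the lower bound of depth k + 2: at least half of
    the 2^(k+2) copies are served by no point. *)
Lemma scaled_error_ge : exists2 c : R, 0 < c &
  forall n, (0 < n)%N -> c <= n%:R `^ error_exponent * V n.
Proof.
exists (2 / 75 ^+ 2) => [|n n0]; first by rewrite divr_gt0// exprn_gt0.
pose k := trunc_log 2 n; have /andP[kn nk] := trunc_log_bounds (ltnSn 1) n0.
rewrite -/k in kn nk.
have pk : (75 / 2) ^+ k <= n%:R `^ error_exponent.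
  rewrite -powR_error_exponent; apply: ge0_ler_powR; rewrite ?nnegrE ?exprn_ge0//.
    exact/ltW/error_exponent_gt0.
  by rewrite -natrX ler_nat.
have Vn : 2 / 75 ^+ 2 * (2 / 75) ^+ k <= V n.
  apply: le_trans (V_lower k.+2 n n0).
  have : n%:R <= 2 * 2 ^+ k :> R by rewrite -exprS -natrX ler_nat ltnW.
  have u0 : 0 < (75 ^+ k)^-1 :> R by rewrite invr_gt0 exprn_gt0.
  rewrite expr_div_n !exprS expr0 !mulr1 !invfM.
  move: (2 ^+ k) ((75 ^+ k)^-1) u0 => u v v0 h.
  nra.
have c0 : 0 <= 2 / 75 ^+ 2 :> R by rewrite divr_ge0// exprn_ge0.
have q0 : 0 < (75 / 2) ^+ k :> R by rewrite exprn_gt0// divr_gt0.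
have -> : 2 / 75 ^+ 2 = (75 / 2) ^+ k * (2 / 75 ^+ 2 * (2 / 75) ^+ k) :> R.
  rewrite mulrCA -exprMn (_ : 75 / 2 * (2 / 75) = 1 :> R); last by field.
  by rewrite expr1n mulr1.
by apply: ler_pM.
Qed.

(** For 2^k <= n < 2^(k+1), compare with 5 * 2^(k-3) <= n points; the finitely
    many n < 8 are covered by the trivial bound 1. *)
Lemma scaled_error_le : exists K : R,
  forall n, (0 < n)%N -> n%:R `^ error_exponent * V n <= K.
Proof.
exists (5 * (75 / 2) ^+ 4) => n n0.
pose k := trunc_log 2 n; have /andP[kn nk] := trunc_log_bounds (ltnSn 1) n0.
rewrite -/k in kn nk.
have pk : n%:R `^ error_exponent <= (75 / 2) ^+ k.+1.
  rewrite -powR_error_exponent; apply: ge0_ler_powR; rewrite ?nnegrE ?exprn_ge0//.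
    exact/ltW/error_exponent_gt0.
  by rewrite -natrX ler_nat ltnW.
have Vn : V n <= 5 * (75 / 2) ^+ 3 * (2 / 75) ^+ k.
  have [k3|k3] := leqP 3 k.
    have -> : 5 * (75 / 2) ^+ 3 * (2 / 75) ^+ k = 5 * (2 / 75) ^+ (k - 3) :> R.
      have h : (75 / 2) ^+ 3 * (2 / 75) ^+ 3 = 1 :> R.
        by rewrite -exprMn (_ : 75 / 2 * (2 / 75) = 1 :> R) ?expr1n//; field.
      have -> : (2 / 75) ^+ k = (2 / 75) ^+ 3 * (2 / 75) ^+ (k - 3) :> R.
        by rewrite -exprD subnKC.
      by rewrite mulrA -(mulrA 5) h mulr1.
    apply: le_trans (V_upper (k - 3)); apply: V_anti.
    have : (2 ^ k = 8 * 2 ^ (k - 3))%N by rewrite -(expnD 2 3) subnKC.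
    have : (0 < 2 ^ (k - 3))%N by rewrite expn_gt0.
    by move: kn; move: (2 ^ k)%N (2 ^ (k - 3))%N => u v; lia.
  apply: (le_trans (V_le1 n n0)).
  by case: k k3 {kn nk pk} => [|[|[|//]]] _; lra.
apply: (@le_trans _ _ ((75 / 2) ^+ k.+1 * (5 * (75 / 2) ^+ 3 * (2 / 75) ^+ k))).
  apply: (@le_trans _ _ (n%:R `^ error_exponent * (5 * (75 / 2) ^+ 3 * (2 / 75) ^+ k))).
    by apply: ler_wpM2l => //; exact: powR_ge0.
  by apply: ler_wpM2r => //; rewrite !mulr_ge0// exprn_ge0// divr_ge0.
rewrite le_eqVlt; apply/orP; left; apply/eqP.
have h : (75 / 2) ^+ k * (2 / 75) ^+ k = 1 :> R.
  by rewrite -exprMn (_ : 75 / 2 * (2 / 75) = 1 :> R) ?expr1n//; field.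
rewrite exprS; move: h; move: ((75 / 2) ^+ k) ((2 / 75) ^+ k) => u v h.
have -> : 75 / 2 * u * (5 * (75 / 2) ^+ 3 * v) = 5 * (75 / 2) ^+ 4 * (u * v).
  by rewrite [(75 / 2) ^+ 4]exprS; ring.
by rewrite h mulr1.
Qed.

End Exponent.

Lemma ln_nat_dvg {R : realType} : (fun n : nat => ln n%:R : R) @ \oo --> +oo%R.
Proof.
apply/cvgryPge => A; exists (Num.truncn (expR A)).+1 => // n /= hn.
have h : expR A < n%:R by apply: lt_le_trans (truncnS_gt _) _; rewrite ler_nat.
by rewrite -[A]expRK ler_ln ?posrE ?expR_gt0// ?ltW//; apply: lt_trans h; exact: expR_gt0.
Qed.

(** The hypothesis says that -ln (V n) - a ln n is bounded, and ln n tends to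
    infinity. *)
Lemma log_ratio_limit {R : realType} (V : nat -> R) (a c K : R) : 0 < a -> 0 < c ->
  (forall n, (0 < n)%N -> c <= n%:R `^ a * V n <= K) ->
  (fun n : nat => 2 * ln n%:R / - ln (V n)) @ \oo --> 2 / a.
Proof.
move=> a0 c0 hV.
have V0 n : (0 < n)%N -> 0 < V n.
  move=> n0; have /andP[h _] := hV n n0.
  have := lt_le_trans c0 h; rewrite pmulr_rgt0//.
  by rewrite powR_gt0// ltr0n.
pose B := `|ln c| + `|ln K|.
have lnV n : (0 < n)%N -> `|- ln (V n) - a * ln n%:R| <= B.
  move=> n0; have /andP[h1 h2] := hV n n0.
  have p0 : 0 < n%:R `^ a :> R by rewrite powR_gt0// ltr0n.
  have y0 : 0 < n%:R `^ a * V n by rewrite mulr_gt0// V0.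
  have -> : - ln (V n) - a * ln n%:R = - ln (n%:R `^ a * V n).
    by rewrite lnM ?posrE// ?V0// ln_powR; ring.
  have l1 : ln c <= ln (n%:R `^ a * V n) by rewrite ler_ln ?posrE.
  have l2 : ln (n%:R `^ a * V n) <= ln K.
    by rewrite ler_ln ?posrE//; exact: lt_le_trans h2.
  rewrite normrN ler_norml /B.
  have := ler_norm (ln K); have := ler_norm (- ln c); rewrite normrN.
  by have := normr_ge0 (ln K); have := normr_ge0 (ln c); lra.
have cv : (fun n : nat => - ln (V n) / (2 * ln n%:R)) @ \oo --> a / 2.
  apply/cvgrPdist_le => e e0.
  move/cvgryPge : (@ln_nat_dvg R) => /(_ (1 + B / e))[M _ hM].
  exists M.+1 => // n /= Mn.
  have n0 : (0 < n)%N by apply: leq_trans Mn.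
  have := hM n (ltnW Mn) => /= ln_large.
  have B0 : 0 <= B by rewrite addr_ge0.
  have Be : 0 <= B / e by rewrite divr_ge0// ltW.
  have ln0 : 0 < ln n%:R :> R by lra.
  have -> : a / 2 - - ln (V n) / (2 * ln n%:R)
     = - ((- ln (V n) - a * ln n%:R) / (2 * ln n%:R)).
    by field; rewrite gt_eqF.
  rewrite normrN normrM normfV (gtr0_norm (mulr_gt0 _ ln0))//.
  rewrite ler_pdivrMr ?mulr_gt0//; apply: (le_trans (lnV n n0)).
  have : B / e <= ln n%:R by lra.
  by rewrite ler_pdivrMr//; nra.
have -> : (fun n : nat => 2 * ln n%:R / - ln (V n)) =
    (fun n : nat => (- ln (V n) / (2 * ln n%:R))^-1).
  by apply/funext => n; rewrite invf_div.
rewrite -(invf_div a 2); apply: cvgV => //.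
by rewrite gt_eqF// divr_gt0.
Qed.

Lemma limn_einf_ge {R : realType} (u : (\bar R)^nat) (l : \bar R) :
  (\forall n \near \oo, (l <= u n)%E) -> (l <= limn_einf u)%E.
Proof.
move=> [N _ hN]; rewrite limn_einf_lim; apply: lime_ge; first exact: is_cvg_einfs.
exists N => // n /= Nn; apply: le_ereal_inf_tmp => _ [m /= nm <-].
by apply: hN; exact: leq_trans nm.
Qed.

Lemma limn_esup_le {R : realType} (u : (\bar R)^nat) (l : \bar R) :
  (\forall n \near \oo, (u n <= l)%E) -> (limn_esup u <= l)%E.
Proof.
move=> [N _ hN]; rewrite limn_esup_lim; apply: lime_le; first exact: is_cvg_esups.
exists N => // n /= Nn; apply: ge_ereal_sup => _ [m /= nm <-].
by apply: hN; exact: leq_trans nm.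
Qed.

Theorem theorem3p8p2 (R : realType) (nu P : probability (measurableTypeR R) R)
    (hnu : is_dyadic_discrete nu) (hP : is_condensation_measure nu P) :
  ~ cvgn (quant_coeff_seq (quant_dimension P) P) /\
  (0 < lower_quant_coeff (quant_dimension P) P)%E /\
  (lower_quant_coeff (quant_dimension P) P
     <= upper_quant_coeff (quant_dimension P) P)%E /\
  (upper_quant_coeff (quant_dimension P) P < +oo)%E.
Proof.
have P1 := P_distortion_le1 nu P hnu hP.
have nu1 := nu_distortion_le1 nu hnu.
have P_upper := error_upper _ _ (qerr_le1 P P1) (qerr_anti P P1)
  (nu_qerr_le nu hnu) (P_qerr_assemble nu P hnu hP).
have [c c0 lower] := scaled_error_ge _ (P_qerr_lower nu P hnu hP).
have [K upper] := scaled_error_le _ (qerr_le1 P P1) (qerr_anti P P1) P_upper.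
pose y n := n%:R `^ error_exponent * qerr P n.
have yb n : (0 < n)%N -> c <= y n <= K by move=> n0; rewrite lower//= upper.
have dimE : quant_dimension P = 2 / error_exponent.
  by apply/cvg_lim => //; exact: (log_ratio_limit _ _ _ _ error_exponent_gt0 c0 yb).
have coefE : quant_coeff_seq (quant_dimension P) P = EFin \o y.
  apply/funext => n; rewrite /quant_coeff_seq /y /= dimE invf_div mulrCA mulfV//.
  (* There is no codebook of size 0, but the factor 0^a kills the error +oo. *)
  rewrite mulr1; have [->|n0] := posnP n.
    by rewrite powR0 ?gt_eqF ?error_exponent_gt0// !mul0r mul0e.
  by rewrite (quant_errorE P P1)// -EFinM.
rewrite /lower_quant_coeff /upper_quant_coeff coefE.
have near_bounds : \forall n \near \oo, (c%:E <= (y n)%:E <= K%:E)%E.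
  by exists 1%N => // n /= n0; rewrite !lee_fin yb.
split; last split; last split.
- move=> /cvg_ex[l cvl].
  have cl : (c%:E <= l)%E.
    apply: (@cvge_ge _ _ _ _ (EFin \o y)) cvl => //.
    by apply: filterS near_bounds => n /andP[].
  have lK : (l <= K%:E)%E.
    apply: (@cvge_le _ _ _ _ (EFin \o y)) cvl => //.
    by apply: filterS near_bounds => n /andP[].
  case: l cl lK cvl => [L| |]//; rewrite !lee_fin => cL _ cvL.
  have cvy : y @ \oo --> L by have /fine_cvgP[_ ] := cvL.
  have eps0 : 0 < 1 / 10000 :> R by lra.
  have [K' K'0 ties] := ties_at_all_scales _ _ (qerr_ge0 P P1) (qerr_le1 P P1)
    (qerr_anti P P1) (P_qerr_lower nu P hnu hP) (qerr_ge0 nu nu1)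
    (nu_qerr_le nu hnu) (P_qerr_assemble nu P hnu hP) _ eps0
    (P_qerr_split nu P hnu hP).
  exact: (ties_prevent_limit _ _ _ _ error_exponent_gt0 K'0 (lt_le_trans c0 cL) ties cvy).
- apply: lt_le_trans (limn_einf_ge _ c%:E _); first by rewrite lte_fin.
  by apply: filterS near_bounds => n /andP[].
- exact: limn_einf_sup.
- apply: le_lt_trans (limn_esup_le _ K%:E _) (ltry _).
  by apply: filterS near_bounds => n /andP[].
Qed.
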